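(* Let $\tau$ be a transportation cost and let $\mu_+,\mu_-$ be nonnegative finite Borel measures on $\mathbb{R}^n$ with bounded support. Then either the minimization problem $\min_{\mathcal F\in\mathrm{rca}(\mathbb{R}^n;\mathbb{R}^n)} J^{\tau,\mu_+,\mu_-}[\mathcal F]$ has a solution (i.e. the infimum is attained), or $J^{\tau,\mu_+,\mu_-}[\mathcal F]=+\infty$ for every $\mathcal F$.
   Context: A transportation cost is a function $\tau:[0,\infty)\to[0,\infty)$ with $\tau(0)=0$, $\tau(w)>0$ for $w>0$, which is non-decreasing, subadditive and lower semi-continuous. $\mathrm{rca}(\mathbb{R}^n;\mathbb{R}^n)$ denotes the $\mathbb{R}^n$-valued finite (regular, countably additive) Borel measures on $\mathbb{R}^n$; $\rightharpoonup^*$ denotes weak-* convergence of measures. A discrete finite mass is a measure $\sum_{i=1}^k a_i\delta_{x_i}$ with $k\in\mathbb N$, $a_i>0$, $x_i\in\mathbb{R}^n$. Given discrete finite masses $\mu_+,\mu_-$ of equal total mass, a discrete mass flux between them is a finite weighted directed graph $G$ with vertex set $V(G)$, a set $E(G)$ of straight oriented segments (edges) $e$ with initial point $e^+$ and final point $e^-$, and weights $w:E(G)\to[0,\infty)$, such that for every $v\in V(G)\cup\operatorname{spt}\mu_+\cup\operatorname{spt}\mu_-$: $\mu_+(\{v\})+\sum_{e:\,e^-=v}w(e)=\mu_-(\{v\})+\sum_{e:\,e^+=v}w(e)$. Its flux is $\mathcal F_G=\sum_{e\in E(G)}w(e)\,\hat e\,\mathcal H^1\llcorner e$ with $\hat e=(e^--e^+)/|e^--e^+|$,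 and its cost is $J^\tau(G)=\sum_{e\in E(G)}\tau(w(e))\,\ell(e)$, $\ell(e)$ the length of $e$. For nonnegative finite Borel measures $\mu_\pm$ and $\mathcal F\in\mathrm{rca}(\mathbb{R}^n;\mathbb{R}^n)$, an approximating graph sequence for $(\mu_+,\mu_-,\mathcal F)$ is a sequence of discrete finite masses $\mu_\pm^k$ and discrete mass fluxes $G_k$ between $\mu_+^k$ and $\mu_-^k$ with $\mu_+^k\rightharpoonup^*\mu_+$, $\mu_-^k\rightharpoonup^*\mu_-$, $\mathcal F_{G_k}\rightharpoonup^*\mathcal F$. Define $J^{\tau,\mu_+,\mu_-}[\mathcal F]=\inf\{\liminf_{k\to\infty}J^\tau(G_k)\}$, the infimum over all approximating graph sequences for $(\mu_+,\mu_-,\mathcal F)$ (equal to $+\infty$ if there is none). *)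

(* Defs.v *)
From HB Require Import structures.
From mathcomp Require Import all_boot all_order all_algebra.
From mathcomp Require Import all_classical all_reals all_analysis.

Set Implicit Arguments.
Unset Strict Implicit.
Unset Printing Implicit Defensive.

Import Order.TTheory GRing.Theory Num.Theory.
Import numFieldNormedType.Exports.

Local Open Scope classical_set_scope.
Local Open Scope ring_scope.

Definition pt (R : realType) (n : nat) := 'rV[R]_n.

Definition borelRn (R : realType) (n : nat) :=
  g_sigma_algebraType (@open 'rV[R]_n).

Definition dotp (R : realType) (n : nat) (u v : 'rV[R]_n) : R :=
  \sum_(i < n) u ord0 i * v ord0 i.
Definition enorm (R : realType) (n : nat) (u : 'rV[R]_n) : R :=
  Num.sqrt (dotp u u).

(** Transportation cost: tau : [0,oo) -> [0,oo) (values of tau on negative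
    reals are irrelevant), tau 0 = 0, tau > 0 on (0,oo), non-decreasing,
    subadditive, lower semicontinuous (on [0,oo)). *)
Definition transportation_cost (R : realType) (tau : R -> R) : Prop :=
  [/\ tau 0 = 0,
      (forall w, 0 < w -> 0 < tau w),
      (forall w w', 0 <= w -> w <= w' -> tau w <= tau w'),
      (forall w w', 0 <= w -> 0 <= w' -> tau (w + w') <= tau w + tau w') &
      (forall w, 0 <= w -> forall e, 0 < e -> exists2 d, 0 < d &
         forall w', 0 <= w' -> `|w' - w| < d -> tau w - e < tau w')].

Definition C0 (R : realType) (n : nat) (f : 'rV[R]_n -> R) : Prop :=
  continuous f /\
  forall e : R, 0 < e -> exists r : R, forall x, r < `|x| -> `|f x| < e.
Definition C0v (R : realType) (n : nat) (f : 'rV[R]_n -> 'rV[R]_n) : Prop :=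
  continuous f /\
  forall e : R, 0 < e -> exists r : R, forall x, r < `|x| -> `|f x| < e.

Definition fmeasure (R : realType) (n : nat) :=
  {finite_measure set (borelRn R n) -> \bar R}.
Definition mint (R : realType) (n : nat) (mu : fmeasure R n)
  (f : 'rV[R]_n -> R) : R :=
  fine (\int[mu]_x (f x)%:E)%E.

Definition bounded_support (R : realType) (n : nat) (mu : fmeasure R n) : Prop :=
  exists r : R, mu [set x : borelRn R n | r < `|x : 'rV[R]_n| ] = 0%E.

Definition charge_on (R : realType) (n : nat) :=
  {charge set (borelRn R n) -> \bar R}.
Definition hahnP (R : realType) (n : nat) (nu : charge_on R n) :=
  cid (Hahn_decomposition nu).
Definition hahnN (R : realType) (n : nat) (nu : charge_on R n) :=
  cid (svalP (hahnP nu)).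
Definition charge_int (R : realType) (n : nat) (nu : charge_on R n)
  (f : 'rV[R]_n -> R) : R :=
  fine (\int[jordan_pos (svalP (hahnN nu))]_x (f x)%:E)%E
  - fine (\int[jordan_neg (svalP (hahnN nu))]_x (f x)%:E)%E.

(** rca(R^n;R^n): R^n-valued finite Borel measures = n-tuples of charges
    (finite Borel measures on R^n are automatically regular).
    Pairing with an R^n-valued test function. *)
Definition vmeasure (R : realType) (n : nat) := 'I_n -> charge_on R n.
Definition vpair (R : realType) (n : nat) (F : vmeasure R n)
  (phi : 'rV[R]_n -> 'rV[R]_n) : R :=
  \sum_(i < n) charge_int (F i) (fun x => phi x ord0 i).

(** Discrete finite masses  sum_i a_i delta_{x_i}, as lists of pairs (a_i, x_i)
    with a_i > 0. *)
Definition dmass (R : realType) (n : nat) := seq (R * 'rV[R]_n).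
Definition dmass_ok (R : realType) (n : nat) (s : dmass R n) : bool :=
  all (fun p => 0 < p.1) s.
Definition dmass_at (R : realType) (n : nat) (s : dmass R n) (v : 'rV[R]_n) : R :=
  \sum_(p <- s | p.2 == v) p.1.
Definition dmass_total (R : realType) (n : nat) (s : dmass R n) : R :=
  \sum_(p <- s) p.1.
Definition dmass_spt (R : realType) (n : nat) (s : dmass R n) : seq 'rV[R]_n :=
  map snd s.
Definition dmass_int (R : realType) (n : nat) (s : dmass R n)
  (f : 'rV[R]_n -> R) : R :=
  \sum_(p <- s) p.1 * f p.2.

(** Finite weighted directed graphs with straight oriented edges.
    An edge is ((e^+, e^-), w(e)): initial point e^+, final point e^-,
    weight w(e). *)
Record graph (R : realType) (n : nat) := Graph {
  gvert : seq 'rV[R]_n ;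
  gedges : seq (('rV[R]_n * 'rV[R]_n) * R) }.

Definition is_dflux (R : realType) (n : nat) (mp mm : dmass R n)
  (G : graph R n) : Prop :=
  [/\ dmass_total mp = dmass_total mm,
      uniq (map fst (gedges G)),
      (forall e, e \in gedges G ->
         [/\ e.1.1 != e.1.2, 0 <= e.2, e.1.1 \in gvert G & e.1.2 \in gvert G]) &
      (forall v, v \in gvert G ++ dmass_spt mp ++ dmass_spt mm ->
         dmass_at mp v + \sum_(e <- gedges G | e.1.2 == v) e.2
         = dmass_at mm v + \sum_(e <- gedges G | e.1.1 == v) e.2)].

(** Integral of phi against w H^1 restricted to the segment [a,b] oriented
    by (b-a)/|b-a|:  int_0^1 phi(a + s(b-a)) . (b-a) ds. *)
Definition seg_int (R : realType) (n : nat) (phi : 'rV[R]_n -> 'rV[R]_n)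
  (a b : 'rV[R]_n) : R :=
  fine (\int[@lebesgue_measure R]_(s in `[0%R, 1%R])
          (dotp (phi (a + s *: (b - a))) (b - a))%:E)%E.

(** Pairing of the flux F_G = sum_e w(e) e_hat H^1|_e with a test function. *)
Definition flux_pair (R : realType) (n : nat) (G : graph R n)
  (phi : 'rV[R]_n -> 'rV[R]_n) : R :=
  \sum_(e <- gedges G) e.2 * seg_int phi e.1.1 e.1.2.

Definition gcost (R : realType) (n : nat) (tau : R -> R) (G : graph R n) : R :=
  \sum_(e <- gedges G) tau e.2 * enorm (e.1.2 - e.1.1).

Definition approx_seq (R : realType) (n : nat) (mup mum : fmeasure R n)
  (F : vmeasure R n) (sp sm : nat -> dmass R n) (G : nat -> graph R n) : Prop :=
  [/\ (forall k, [/\ dmass_ok (sp k), dmass_ok (sm k) & is_dflux (sp k) (sm k) (G k)]),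
      (forall f, C0 f -> (fun k => dmass_int (sp k) f) @ \oo --> mint mup f),
      (forall f, C0 f -> (fun k => dmass_int (sm k) f) @ \oo --> mint mum f) &
      (forall phi, C0v phi -> (fun k => flux_pair (G k) phi) @ \oo --> vpair F phi)].

(** The relaxed functional J^{tau,mu+,mu-}[F] (inf of the empty set = +oo). *)
Definition Jrel (R : realType) (n : nat) (tau : R -> R) (mup mum : fmeasure R n)
  (F : vmeasure R n) : \bar R :=
  ereal_inf [set x : \bar R | exists sp sm G,
     approx_seq mup mum F sp sm G /\
     x = limn_einf (fun k => (gcost tau (G k))%:E)].

(* Main.v *)
(* Let [m0] be the infimum of the relaxed cost.  Take approximating sequences
   whose lower limits tend to [m0] and, along a diagonal choice, modify the
   graphs so that they become compact:

   - Mass may escape to infinity, so a graph is truncated at a level [|x| <= s].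
     An edge crossing level [s] costs at least [tau] of its weight, so averaging
     over levels gives an [s] crossed by little [tau]-mass, hence by little mass.
     The cut edges become sources and sinks at their inner endpoints.
   - Circulations are subtracted until every weight is bounded by the total
     mass; on bounded weights [tau] dominates a multiple of the identity, so the
     cost bounds the total variation of the flux.

   Weak-* compactness of the resulting fluxes needs no representation theorem:
   Riemann sums turn a flux into discrete masses, the points are coded by binary
   expansions after compactifying the space to a cube, and the masses of all
   cylinders converge along a subsequence.  The limits define a partition of an
   interval into nested subintervals, and the limit measure is the image of the
   Lebesgue measure under the map reading off the branch of a point. *)

Require Import Defs.
From HB Require Import structures.
From mathcomp Require Import all_boot all_order all_algebra.
From mathcomp Require Import all_classical all_reals all_analysis.
From mathcomp Require Import measurable_realfun ring lra.

Set Implicit Arguments.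
Unset Strict Implicit.
Unset Printing Implicit Defensive.

Import Order.TTheory GRing.Theory Num.Theory.
Import numFieldNormedType.Exports.

Local Open Scope classical_set_scope.
Local Open Scope ring_scope.

(** * Integrals and finite labellings *)

(** Test functions vanish at infinity, so weak-* convergence leaves the total masses of the
    approximating [sp k] and [sm k] uncontrolled. This fixes the order of the two modifications: the
    weight bound left by removing circulations is a total mass, and only truncation makes that mass
    bounded. Bounded support makes truncation harmless: if [mup] and [mum] live in radius [r],
    testing against two cutoffs shows that little mass lies between radius [r + 1] and the cutting
    level. The level ranges over an interval of length proportional to [j + 1] at stage [j], so the
    fluxes may still drift to infinity; compactifying to a cube sends what escapes to the unit
    sphere, where the transported test functions are 0.

    Both modifications alter the flux, so the limit obtained need not be related to the competitors
    used at each stage. This does no harm: the modified graphs form an admissible sequence for their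
    own limit, and the relaxed cost, being an infimum over sequences, is there at most the limit
    [m0] of their costs. The diagonal choice needs weak-* closeness as a property of a single
    discrete mass; [weakly_close] provides it. *)

Lemma bigcup_label (T : Type) (I : finType) (D : set T) (lab : T -> I) :
  \big[setU/set0]_(i <- index_enum I) (D `&` [set t | lab t = i]) = D.
Proof.
apply/seteqP; split => t.
  by rewrite -bigcup_seq => -[i _ []].
by move=> Dt; rewrite -bigcup_seq; exists (lab t) => //=; rewrite mem_index_enum.
Qed.

(** One estimate, cell by cell, for three uses: the cylinders of the tree, the subintervals of a
    Riemann sum and, with a single label, the comparison of two integrals. *)
Lemma integral_label_approx (d : measure_display) (T : measurableType d)
    (R : realType) (mu : {measure set T -> \bar R}) (D : set T) (I : finType)
    (lab : T -> I) (h : T -> R) (c : I -> R) (e : R) :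
  measurable D -> (mu D < +oo)%E ->
  (forall i, measurable (D `&` [set t | lab t = i])) ->
  measurable_fun D h -> (forall t, D t -> `|h t - c (lab t)| <= e) ->
  `|fine (\int[mu]_(t in D) (h t)%:E)%E
    - \sum_i c i * fine (mu (D `&` [set t | lab t = i]))| <= e * fine (mu D).
Proof.
move=> mD fD ml mh he.
pose Di i := D `&` [set t | lab t = i].
have mDi i : measurable (Di i) by exact: ml.
have DiD i : Di i `<=` D by exact: subIsetl.
have fDi i : (mu (Di i) < +oo)%E.
  by apply: le_lt_trans fD; apply: le_measure; rewrite ?inE.
have mhi i : measurable_fun (Di i) h by exact: measurable_funS mh.
have hi i : mu.-integrable (Di i) (EFin \o h).
  apply: measurable_bounded_integrable => //.
  exists (`|c i| + `|e|); split; first exact: num_real.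
  move=> M HM t [Dt lt]; apply/ltW/(le_lt_trans _ HM).
  rewrite -[h t](subrK (c i)) (le_trans (ler_normD _ _))// addrC lerD2l.
  by rewrite -lt (le_trans (he _ Dt))// ler_norm.
have tD : trivIset [set` index_enum I] Di.
  apply/trivIsetP => i j _ _ /eqP ij; apply/seteqP; split => // t [[_ /= li] [_ /= lj]].
  by case: ij; rewrite -li -lj.
have Dsum : \big[setU/set0]_(i <- index_enum I) Di i = D := bigcup_label D lab.
have split_int g : measurable_fun D g ->
    (forall i, mu.-integrable (Di i) (EFin \o g)) ->
    fine (\int[mu]_(t in D) (g t)%:E)%E = \sum_i \int[mu]_(t in Di i) g t.
  move=> mg ig; rewrite -{1}Dsum (@integral_bigsetU_EFin _ _ _ mu _ Di) //; first last.
    by rewrite Dsum; exact/measurable_EFinP.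
  - exact: index_enum_uniq.
  by rewrite -sum_fine// => i _; exact: integrable_fin_num.
have ci r i : mu.-integrable (Di i) (EFin \o cst r).
  by apply: measurable_bounded_integrable => //; exists `|r|; split => // M HM t _ /=; exact: ltW.
have -> : fine (mu D) = \sum_i fine (mu (Di i)).
  have E1 : \int[mu]_(t in D) 1 = \sum_i \int[mu]_(t in Di i) 1.
    exact: (split_int (cst 1) (measurable_cst _) (ci 1)).
  rewrite -[LHS]mul1r -Rintegral_cst// E1.
  by apply: eq_bigr => i _; rewrite Rintegral_cst// mul1r.
rewrite split_int//.
rewrite -sumrB mulr_sumr (le_trans (ler_norm_sum _ _ _))//.
apply: ler_sum => i _.
have -> : c i * fine (mu (D `&` [set t | lab t = i])) = \int[mu]_(t in Di i) cst (c i) t.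
  by rewrite Rintegral_cst.
rewrite -(RintegralB (mDi i) (hi i) (ci (c i) i)).
have hci : mu.-integrable (Di i) (EFin \o (fun t => h t - c i)).
  rewrite (_ : _ \o _ = (EFin \o h) \- (EFin \o cst (c i)))%E//.
  by apply: integrableB => //; exact: ci.
apply: (le_trans (le_normr_Rintegral _ hci)) => //.
rewrite -Rintegral_cst//; apply: le_Rintegral => //.
- rewrite (_ : _ \o _ = abse \o (EFin \o (fun t => h t - c i)))//.
  exact: integrable_abse.
- exact: ci.
- by move=> t [Dt lt]; rewrite -lt; exact: he.
Qed.

(** * Mass distributions on the binary tree *)

(* Words are stored with the most recent bit first. *)
Definition prefix_word (b : nat -> bool) (N : nat) : seq bool := rev (mkseq b N).

Lemma prefix_wordS b N : prefix_word b N.+1 = b N :: prefix_word b N.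
Proof. by rewrite /prefix_word mkseqS rev_rcons. Qed.

Lemma size_prefix_word b N : size (prefix_word b N) = N.
Proof. by rewrite size_rev size_mkseq. Qed.

Lemma prefix_word_eq b b' N : prefix_word b N = prefix_word b' N ->
  forall l, (l < N)%N -> b l = b' l.
Proof.
move=> /(congr1 rev); rewrite !revK => E l lN.
by rewrite -(nth_mkseq false b lN) E nth_mkseq.
Qed.

Lemma prefix_word_nth u : prefix_word (nth false (rev u)) (size u) = u.
Proof. by rewrite /prefix_word -(size_rev u) mkseq_nth revK. Qed.

Record mass_tree (R : realType) := MassTree {
  mtree :> seq bool -> R ;
  mtree_ge0 : forall u, 0 <= mtree u ;
  mtree_split : forall u, mtree u = mtree (false :: u) + mtree (true :: u) }.

Section MassTree.
Variables (R : realType) (m : mass_tree R).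

(* The words of each length label consecutive intervals of lengths [m u]. *)
Fixpoint tree_start (u : seq bool) : R :=
  if u is b :: u' then tree_start u' + (if b then m (false :: u') else 0) else 0.

Fixpoint tree_word (N : nat) (t : R) : seq bool :=
  if N is N'.+1 then
    let u := tree_word N' t in (tree_start u + m (false :: u) <= t) :: u
  else [::].

Definition tree_branch (t : R) (N : nat) : bool :=
  tree_start (tree_word N t) + m (false :: tree_word N t) <= t.

Lemma prefix_tree_branch t N : prefix_word (tree_branch t) N = tree_word N t.
Proof. by elim: N => // N IH; rewrite prefix_wordS IH. Qed.

Lemma size_tree_word N t : size (tree_word N t) = N.
Proof. by rewrite -prefix_tree_branch size_prefix_word. Qed.

Lemma tree_start_ge0 u : 0 <= tree_start u.
Proof.
by elim: u => //= b u IH; rewrite addr_ge0//; case: b => //; exact: mtree_ge0.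
Qed.

Lemma tree_end_le u : tree_start u + m u <= m [::].
Proof.
elim: u => [|b u IH] /=; first by rewrite add0r.
apply: le_trans IH; rewrite -addrA lerD2l [leRHS]mtree_split.
by case: b => //; rewrite add0r lerDl mtree_ge0.
Qed.

(** The intervals of two children partition that of their parent. If [t] has the parent's word, the
    last bit decides; otherwise [t] is already outside the parent's interval, hence outside the
    child's. *)
Lemma tree_wordP u t : 0 <= t < m [::] ->
  (tree_word (size u) t == u) = (tree_start u <= t < tree_start u + m u).
Proof.
move=> t0; elim: u => [|b u IH] /=; first by rewrite add0r t0.
rewrite eqseq_cons andbC; have [E|NE] := eqVneq (tree_word (size u) t) u.
  rewrite E /=; move: IH; rewrite E eqxx => /esym/andP[l1 l2].
  case: b => /=.
    by rewrite eqb_id -addrA -mtree_split l2 andbT.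
  by rewrite addr0 eqbF_neg -ltNge l1.
move: IH; rewrite (negbTE NE) /= => /esym/negbT; rewrite negb_and -ltNge -leNgt => H.
apply/esym/negbTE; rewrite negb_and -ltNge -leNgt; move: H => /orP[H|H].
  by apply/orP; left; apply: (lt_le_trans H); rewrite lerDl; case: b => //; exact: mtree_ge0.
apply/orP; right; apply: le_trans H; rewrite -addrA lerD2l [leRHS]mtree_split.
by case: b; rewrite ?lexx// add0r lerDl mtree_ge0.
Qed.

Lemma measurable_tree_word N u : measurable [set t : R | tree_word N t = u].
Proof.
elim: N u => [|N IH] [|b u] /=.
- by rewrite (_ : [set _ | _] = setT)//; apply/seteqP; split.
- by rewrite (_ : [set _ | _] = set0)//; apply/seteqP; split.
- by rewrite (_ : [set _ | _] = set0)//; apply/seteqP; split.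
set c := tree_start u + m (false :: u).
rewrite (_ : [set _ | _] = [set t | tree_word N t = u] `&`
    (if b then `[c, +oo[%classic else `]-oo, c[%classic)); last first.
  apply/seteqP; split => t /=.
    move=> [bE uE]; split => //; move: bE; rewrite uE => <-.
    by rewrite -/c; case: (leP c t) => H /=; rewrite in_itv /= ?H.
  move=> [->]; rewrite -/c; case: b => /=; rewrite in_itv /= ?andbT.
    by move=> ->.
  by rewrite leNgt => ->.
by apply: measurableI => //; case: b.
Qed.

Definition tree_itv : set R := `[0, m [::][%classic.

Lemma lebesgue_tree_word u :
  lebesgue_measure (tree_itv `&` [set t | tree_word (size u) t = u])
  = (m u)%:E.
Proof.
rewrite (_ : _ `&` _ = `[tree_start u, tree_start u + m u[%classic); last first.
  apply/seteqP; split => t; rewrite /tree_itv /= !in_itv /=.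
    by move=> [t0 /eqP]; rewrite tree_wordP.
  move=> H; have t0 : 0 <= t < m [::].
    case/andP: H => H1 H2; rewrite (le_trans (tree_start_ge0 u) H1) /=.
    exact: lt_le_trans H2 (tree_end_le u).
  by split => //; apply/eqP; rewrite tree_wordP.
rewrite lebesgue_measure_itv /= lte_fin ltrDl.
case: ltP => [m0|m0]; first by rewrite -EFinB addrC addKr.
by congr EFin; apply/eqP; rewrite eq_le m0 mtree_ge0.
Qed.

End MassTree.

(** * Binary expansions of points of the unit cube *)

Section BinaryValue.
Variable R : realType.
Implicit Types (b : nat -> bool) (y : R).

Definition bin_sum b (N : nat) : R := \sum_(j < N) (b j)%:R * 2^-1 ^+ j.+1.

Definition bin_val b : R := sup (range (bin_sum b)).

Lemma bin_sumS b N : bin_sum b N.+1 = bin_sum b N + (b N)%:R * 2^-1 ^+ N.+1.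
Proof. by rewrite /bin_sum big_ord_recr. Qed.

Let half_ge0 N : 0 <= 2^-1 ^+ N :> R.
Proof. by rewrite exprn_ge0// invr_ge0. Qed.

Let halfS N : 2^-1 ^+ N = 2^-1 ^+ N.+1 + 2^-1 ^+ N.+1 :> R.
Proof. rewrite exprS; lra. Qed.

Lemma bin_sum_nd b N M : (N <= M)%N -> bin_sum b N <= bin_sum b M.
Proof.
move=> /subnK <-; elim: (M - N)%N => // k IH; apply: (le_trans IH).
by rewrite addSn bin_sumS lerDl mulr_ge0.
Qed.

Lemma bin_sum_end_ni b N M : (N <= M)%N ->
  bin_sum b M + 2^-1 ^+ M <= bin_sum b N + 2^-1 ^+ N.
Proof.
move=> /subnK <-; elim: (M - N)%N => // k IH; apply: le_trans IH.
rewrite addSn bin_sumS -addrA lerD2l [leRHS]halfS lerD2r.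
by case: (b _); rewrite ?mul1r ?mul0r.
Qed.

Lemma bin_sum_ub b N : ubound (range (bin_sum b)) (bin_sum b N + 2^-1 ^+ N).
Proof.
move=> _ [M _ <-]; have [NM|/ltnW MN] := leqP N M.
  by apply: le_trans (bin_sum_end_ni b NM); rewrite lerDl.
by apply: (le_trans (bin_sum_nd b MN)); rewrite lerDl.
Qed.

Lemma bin_val_bounds b N : bin_sum b N <= bin_val b <= bin_sum b N + 2^-1 ^+ N.
Proof.
apply/andP; split.
  apply: ub_le_sup; last by exists N.
  by exists (bin_sum b 0 + 2^-1 ^+ 0); exact: bin_sum_ub.
by apply: ge_sup; [exists (bin_sum b 0), 0%N | exact: bin_sum_ub].
Qed.

Lemma bin_val_close b b' N : (forall j, (j < N)%N -> b j = b' j) ->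
  `|bin_val b - bin_val b'| <= 2^-1 ^+ N.
Proof.
move=> E; have S : bin_sum b N = bin_sum b' N by apply: eq_bigr => j _; rewrite E.
have := bin_val_bounds b N; have := bin_val_bounds b' N; rewrite S ler_norml.
lra.
Qed.

Fixpoint greedy_sum y (N : nat) : R :=
  if N is N'.+1 then greedy_sum y N' + (greedy_sum y N' + 2^-1 ^+ N <= y)%R%:R * 2^-1 ^+ N
  else 0.

Definition greedy_bits y (N : nat) : bool := greedy_sum y N + 2^-1 ^+ N.+1 <= y.

Lemma greedy_sumE y N : greedy_sum y N = bin_sum (greedy_bits y) N.
Proof.
elim: N => [|N IH]; first by rewrite /bin_sum big_ord0.
by rewrite bin_sumS -IH.
Qed.

(** The upper bound is not strict so as to admit [y = 1], whose greedy bits are all 1. *)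
Lemma greedy_sum_bounds y N : 0 <= y <= 1 ->
  greedy_sum y N <= y <= greedy_sum y N + 2^-1 ^+ N.
Proof.
move=> y01; elim: N => [|N IH] /=; first by rewrite expr0 add0r.
have := halfS N; move: IH; set h := 2^-1 ^+ N.+1; set g := greedy_sum y N => IH hE.
by case: (leP (g + h) y) => H /=; lra.
Qed.

Lemma half_exp_small e : 0 < e :> R -> exists N, 2^-1 ^+ N < e.
Proof.
move=> e0; have : 2^-1 ^+ k @[k --> \oo] --> (0 : R).
  by apply: cvg_expr; rewrite ger0_norm; lra.
move=> /cvgrPdist_lt/(_ _ e0)[N _ /(_ N (leqnn N))].
by rewrite sub0r normrN ger0_norm// => ?; exists N.
Qed.

Lemma greedy_bitsK y : 0 <= y <= 1 -> bin_val (greedy_bits y) = y.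
Proof.
move=> y01; apply/eqP; rewrite -subr_eq0 -normr_le0 leNgt; apply/negP => H.
have [N hN] := half_exp_small H.
have := bin_val_bounds (greedy_bits y) N; have := greedy_sum_bounds N y01.
rewrite greedy_sumE => H1 H2; move: hN; apply/negP; rewrite -leNgt ler_norml.
lra.
Qed.

End BinaryValue.

(** * Coding the points of a cube by one bit stream *)

Section Cube.
Variables (R : realType) (n : nat).

Lemma le_mx_norm (x : 'rV[R]_n) r :
  0 <= r -> (forall i, `|x ord0 i| <= r) -> `|x| <= r.
Proof.
move=> r0 H; rewrite [leLHS]/Num.Def.normr /= mx_normrE; apply: bigmax_le => // -[i j] _ /=.
by rewrite ord1.
Qed.

Lemma mx_norm_ge_coord (x : 'rV[R]_n) i : `|x ord0 i| <= `|x|.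
Proof.
rewrite [leRHS]/Num.Def.normr /= mx_normrE.
by apply/bigmax_geP; right; exists (ord0, i).
Qed.

(** The coordinates are interleaved: bit [j * n + i] is the [j]-th bit of coordinate [i], so a
    prefix of length [N * n] fixes [N] bits of every coordinate. *)
Definition cube_point (b : nat -> bool) : 'rV[R]_n :=
  \row_i (2 * bin_val R (fun j => b (j * n + i)%N) - 1).

Lemma cube_point_close b b' N :
  prefix_word b (N * n) = prefix_word b' (N * n) ->
  `|cube_point b - cube_point b'| <= 2 * 2^-1 ^+ N.
Proof.
move=> /prefix_word_eq E; apply: le_mx_norm => [|i].
  by rewrite mulr_ge0// exprn_ge0// invr_ge0.
rewrite !mxE opprB addrA subrK -mulrBr normrM ger0_norm// ler_pM2l//.
apply: bin_val_close => j jN; apply: E.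
by apply: leq_trans (leq_mul jN (leqnn n)); rewrite mulSn addnC ltn_add2r.
Qed.

Lemma cube_point_surj (x : 'rV[R]_n) : `|x| <= 1 -> exists b, cube_point b = x.
Proof.
move=> x1; pose y i := (x ord0 i + 1) / 2.
have y01 i : 0 <= y i <= 1.
  have := le_trans (mx_norm_ge_coord x i) x1; rewrite ler_norml /y => ?; lra.
(* The remainder names the coordinate and the quotient its bit; [insub] fails only for [n = 0], when
   there is no coordinate to read. *)
exists (fun l => if insub (l %% n)%N is Some i then greedy_bits (y i) (l %/ n) else false).
apply/rowP => i; rewrite mxE.
have n0 : (0 < n)%N by case: (n) i => // -[].
rewrite (_ : (fun j => _) = greedy_bits (y i)); last first.
  apply/funext => j; rewrite modnMDl modn_small ?ltn_ord// valK.
  by rewrite divnMDl// divn_small ?ltn_ord// addn0.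
by rewrite greedy_bitsK// /y; field.
Qed.

End Cube.

(** * Transport to the unit ball *)

Section PullBall.
Variables (R : realType) (V : normedModType R).
Implicit Types (f : V -> R) (x y : V).

(* [f] transported to the open unit ball by [x |-> x / (1 + |x|)] *)
Definition pull_ball f y : R :=
  if `|y| < 1 then f ((1 - `|y|)^-1 *: y) else 0.

Lemma pull_ball_out f y : 1 < `|y| -> pull_ball f y = 0.
Proof. by move=> y1; rewrite /pull_ball ltNge (ltW y1). Qed.

Definition to_ball x : V := (1 + `|x|)^-1 *: x.

Lemma norm_to_ball x : `|to_ball x| = `|x| / (1 + `|x|).
Proof. by rewrite normrZ gtr0_norm ?invr_gt0 ?ltr_pwDl// mulrC. Qed.

Lemma norm_to_ball_lt1 x : `|to_ball x| < 1.
Proof. by rewrite norm_to_ball ltr_pdivrMr ?ltr_pwDl// mul1r ltrDr. Qed.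

Lemma pull_ballK f x : pull_ball f (to_ball x) = f x.
Proof.
rewrite /pull_ball norm_to_ball_lt1 norm_to_ball; congr f.
have p : 0 < 1 + `|x| by rewrite ltr_pwDl.
rewrite /to_ball scalerA -[RHS]scale1r; congr (_ *: _).
have /gt_eqF/negbT px := p.
have -> : 1 - `|x| / (1 + `|x|) = (1 + `|x|)^-1.
  by apply: (mulIf px); rewrite mulrBl mul1r divfK// mulVf// addrK.
by rewrite invrK mulfV.
Qed.

Lemma from_ball_continuous y : `|y| < 1 ->
  {for y, continuous (fun y : V => (1 - `|y|)^-1 *: y)}.
Proof.
move=> y1; have H : (1 - `|z|)^-1 @[z --> y] --> (1 - `|y|)^-1.
  have ny : 1 - `|y| != 0 by rewrite gt_eqF// subr_gt0.
  apply: (cvgV ny).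
  exact: (cvgB (cvg_cst (1 : R)) (@norm_continuous R _ y)).
exact: (cvgZ H cvg_id).
Qed.

Lemma open_unit_ball : open [set y : V | `|y| < 1].
Proof.
rewrite (_ : [set y | _] = (fun x : V => `|x|) @^-1` [set` `]-oo, 1[]); last first.
  by apply/seteqP; split => x /=; rewrite in_itv.
apply: open_comp => [x _|]; first exact: norm_continuous.
exact: interval_open.
Qed.

(** Vanishing at infinity makes the extension by 0 continuous across the unit sphere: [r / (1 + r)]
    is the norm to which norm [r] is sent, so a point of the ball beyond it comes from norm larger
    than [r]. *)
Lemma pull_ball_continuous f : continuous f ->
  (forall e : R, 0 < e -> exists r : R, forall x, r < `|x| -> `|f x| < e) ->
  continuous (pull_ball f).
Proof.
move=> cf f0 y; have [y1|y1] := ltP `|y| 1.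
  rewrite /continuous_at {2}/pull_ball y1.
  have /near_eq_cvg E : \forall z \near y, f ((1 - `|z|)^-1 *: z) = pull_ball f z.
    have : nbhs y [set z | `|z| < 1] by apply: open_nbhs_nbhs; split => //; exact: open_unit_ball.
    by apply: filterS => z /= z1; rewrite /pull_ball z1.
  apply: (cvg_trans E).
  apply: (@continuous_comp _ _ _ (fun y : V => (1 - `|y|)^-1 *: y) f).
    exact: from_ball_continuous.
  exact: cf.
rewrite /continuous_at {2}/pull_ball ltNge y1 /=.
apply/cvgrPdist_lt => e e0; have [r0 Hr0] := f0 _ e0.
pose r := Num.max r0 0; have r_ge0 : 0 <= r by rewrite le_max lexx orbT.
have r1 : 0 < 1 + r by rewrite ltr_pwDl.
have : nbhs y [set z | r / (1 + r) < `|z|].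
  have := @norm_continuous _ _ y; rewrite /continuous_at => /cvgrPdist_lt/(_ (1 + r)^-1).
  rewrite invr_gt0 r1 => /(_ isT); apply: filterS => z /=; rewrite ltr_norml => /andP[_ H].
  have : r / (1 + r) = 1 - (1 + r)^-1 by field; lra.
  move=> ->; lra.
apply: filterS => z /= rz; rewrite sub0r normrN /pull_ball.
have [z1|z1] := ltP `|z| 1; last by rewrite normr0.
apply: Hr0; apply: (@le_lt_trans _ _ r); first by rewrite le_max lexx.
rewrite normrZ gtr0_norm ?invr_gt0 ?subr_gt0// mulrC ltr_pdivlMr ?subr_gt0//.
move: rz; rewrite ltr_pdivrMr//; lra.
Qed.

End PullBall.

(** * Continuous functions vanishing at infinity *)

Section Vanishing.
Variables (R : realType) (n : nat).
Implicit Types (f : 'rV[R]_n -> R) (x y : 'rV[R]_n).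

Lemma closed_ball_compact (r : R) : compact [set x : 'rV[R]_n | `|x| <= r].
Proof.
apply: bounded_closed_compact.
  exists r; split; first exact: num_real.
  by move=> M rM x /= xr; exact: le_trans (ltW rM).
rewrite (_ : [set x | _] = (fun x : 'rV[R]_n => `|x|) @^-1` [set` `]-oo, r]]); last first.
  by apply/seteqP; split => x /=; rewrite in_itv.
apply: closed_comp => [x _|]; first exact: norm_continuous.
exact: interval_closed.
Qed.

(** Only [x] is confined to the ball, so pairs straddling its boundary are covered too; in the
    vanishing case the remaining pairs have both points outside. *)
Lemma unif_continuous_on_ball (W : normedModType R) (f : 'rV[R]_n -> W) (r e : R) :
  continuous f -> 0 < e ->
  exists2 d, 0 < d & forall x y, `|x| <= r -> `|x - y| < d -> `|f x - f y| < e.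
Proof.
move=> cf e0.
have /compact_near_coveringP K := @closed_ball_compact r.
have := K R 0^'+ (fun d x => forall y, `|x - y| < d -> `|f x - f y| < e) _ _.
case => [x _|d /= d0 Hd].
  have /cvgrPdist_lt/(_ (e / 2)) := cf x; rewrite divr_gt0// => /(_ isT).
  move=> /nbhs_normP[d /= d0 Hd].
  exists (ball x (d / 2), [set t | t < d / 2]); first split => /=.
  - by apply: nbhsx_ballx; rewrite divr_gt0.
  - by apply: nbhs_right_lt; rewrite divr_gt0.
  move=> [x' t] /= []; rewrite -ball_normE /= => xx' td y x'y.
  have H1 : `|f x - f x'| < e / 2.
    by apply: Hd; rewrite /= (lt_trans xx')// ltr_pdivrMr// ltr_pMr// ltr1n.
  have H2 : `|f x - f y| < e / 2.
    apply: Hd => /=; rewrite -[x](subrK x') -addrA (le_lt_trans (ler_normD _ _))//.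
    by rewrite [ltRHS]splitr ltrD// (lt_trans x'y).
  rewrite -[f x'](subrK (f x)) -addrA (le_lt_trans (ler_normD _ _))// distrC.
  by rewrite [ltRHS]splitr ltrD.
exists (d / 2); first by rewrite divr_gt0.
move=> x y xr; apply: (Hd (d / 2)) => //=.
  by rewrite sub0r normrN gtr0_norm ?divr_gt0// ltr_pdivrMr// ltr_pMr// ltr1n.
by rewrite divr_gt0.
Qed.

Lemma unif_continuous_vanishing (W : normedModType R) (f : 'rV[R]_n -> W) (e : R) :
  continuous f ->
  (forall e : R, 0 < e -> exists r : R, forall x, r < `|x| -> `|f x| < e) ->
  0 < e ->
  exists2 d, 0 < d & forall x y, `|x - y| < d -> `|f x - f y| < e.
Proof.
move=> cf f0 e0; have e20 : 0 < e / 2 by rewrite divr_gt0.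
have [r Hr] := f0 _ e20.
have [d d0 Hd] := unif_continuous_on_ball r cf e0.
exists d => // x y xy; have [xr|xr] := leP `|x| r; first exact: Hd.
have [yr|yr] := leP `|y| r; first by rewrite distrC; apply: Hd; rewrite // distrC.
by rewrite (le_lt_trans (ler_normB _ _))// [ltRHS]splitr ltrD// Hr.
Qed.

Lemma C0_unif_continuous f (e : R) : C0 f -> 0 < e ->
  exists2 d, 0 < d & forall x y, `|x - y| < d -> `|f x - f y| < e.
Proof. by move=> [cf f0]; exact: unif_continuous_vanishing. Qed.

Lemma C0_bounded f : C0 f -> exists2 B, 0 <= B & forall x, `|f x| <= B.
Proof.
move=> [cf f0]; have [r Hr] := f0 _ ltr01.
have : bounded_set (f @` [set x : 'rV[R]_n | `|x| <= r]).
  apply: compact_bounded; apply: continuous_compact; last exact: closed_ball_compact.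
  exact: continuous_subspaceT.
case=> M [Mr HM]; exists (`|M| + 1) => [|x]; first by rewrite addr_ge0.
have [xr|xr] := leP `|x| r.
  by apply: HM; [rewrite (le_lt_trans (ler_norm _))// ltrDl | exists x].
by rewrite (le_trans (ltW (Hr _ xr)))// lerDr.
Qed.

Lemma continuous_borel_measurable f : continuous f ->
  measurable_fun [set: borelRn R n] (f : borelRn R n -> R).
Proof.
move=> /continuousP cf; apply: (measurability _ (RGenOpens.measurableE R)).
move=> _ [_ [a [b -> <-]]]; rewrite setTI; apply: sub_sigma_algebra.
by apply: cf; exact: interval_open.
Qed.

Lemma C0_integrable (mu : {finite_measure set (borelRn R n) -> \bar R}) f :
  C0 f -> mu.-integrable setT (fun x => (f x)%:E).
Proof.
move=> Cf; have [B B0 HB] := C0_bounded Cf.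
apply: (@measurable_bounded_integrable _ _ _ mu f setT) => //.
- by rewrite ltey_eq fin_num_measure.
- by apply: continuous_borel_measurable; case: Cf.
- exists B; split; first exact: num_real.
  by move=> M BM x _; exact: le_trans (ltW BM).
Qed.

Lemma pull_ball_C0 f : C0 f -> C0 (pull_ball f).
Proof.
move=> [cf f0]; split; first exact: (pull_ball_continuous cf f0).
move=> e e0; exists 1 => y y1.
by rewrite (pull_ball_out f y1) normr0.
Qed.

End Vanishing.

(** * The measure carried by a mass tree *)

Section TreeMeasure.
Variables (R : realType) (n : nat) (m : mass_tree R).

Definition tree_point (t : measurableTypeR R) : 'rV[R]_n :=
  cube_point R n (tree_branch m t).

(** An open set pulls back to the union of those cylinders all of whose points lie in it, and there
    are countably many words. *)
Lemma measurable_tree_point (U : set 'rV[R]_n) : open U ->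
  measurable [set t | U (tree_point t)].
Proof.
move=> oU; pose good u := forall b, prefix_word b (size u) = u -> U (cube_point R n b).
rewrite (_ : [set _ | _] = \bigcup_u
    (if `[< good u >] then [set t | tree_word m (size u) t = u] else set0)).
  apply: countable_bigcupT_measurable => [|u]; first exact: countableP.
  by case: asboolP => // _; exact: measurable_tree_word.
apply/seteqP; split => t /=.
  move=> Ut; have [e /= e0 He] : nbhs_ball (tree_point t) U.
    by apply/nbhs_ballP; apply: open_nbhs_nbhs.
  have e20 : 0 < e / 2 by rewrite divr_gt0.
  have [N hN] := half_exp_small e20.
  exists (tree_word m (N * n) t) => //; rewrite asboolT /= ?size_tree_word//.
  move=> b; rewrite size_tree_word => bE; apply: He; rewrite -ball_normE /=.
  apply: (@le_lt_trans _ _ (2 * 2^-1 ^+ N)); last by lra.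
  by apply: cube_point_close; rewrite prefix_tree_branch bE.
move=> [u _]; case: asboolP => // gu /= tu.
by apply: gu; rewrite prefix_tree_branch.
Qed.

(** Branches whose point has norm 1 carry the mass that escaped to infinity; they are dropped, in
    accordance with [pull_ball] being 0 there. *)
Definition tree_dom : set (measurableTypeR R) :=
  tree_itv m `&` [set t | `|tree_point t| < 1].

Lemma measurable_tree_dom : measurable tree_dom.
Proof.
apply: measurableI; first exact: measurable_itv.
by apply: (@measurable_tree_point [set y | `|y| < 1]); exact: open_unit_ball.
Qed.

(** The value 0 is a placeholder on the complement of the open ball, which the restricted Lebesgue
    measure does not see. *)
Definition tree_map (t : measurableTypeR R) : borelRn R n :=
  if `|tree_point t| < 1
  then (1 - `|tree_point t|)^-1 *: tree_point t else 0.

Lemma measurable_tree_map : measurable_fun setT tree_map.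
Proof.
apply: (@measurability _ _ _ (borelRn R n) _ _ (@open 'rV[R]_n)) => //.
move=> _ [U oU <-]; rewrite setTI.
pose B1 := [set y : 'rV[R]_n | `|y| < 1].
pose W := [set y : 'rV[R]_n | `|y| < 1 /\ U ((1 - `|y|)^-1 *: y)].
have oB1 : open B1 by exact: open_unit_ball.
have oW : open W.
  rewrite openE => y [y1 Uy]; rewrite /interior.
  apply: filterI; first exact: (open_nbhs_nbhs (conj oB1 y1)).
  by apply: (from_ball_continuous y1); exact: (open_nbhs_nbhs (conj oU Uy)).
rewrite (_ : _ @^-1` _ = [set t | W (tree_point t)] `|`
   (if `[< U 0 >] then ~` [set t | B1 (tree_point t)] else set0)).
  apply: measurableU; first exact: measurable_tree_point.
  by case: asbool => //; apply: measurableC; exact: measurable_tree_point.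
apply/seteqP; split => t /=; rewrite /tree_map.
  case: ifPn => [t1 Ut|t1 U0]; first by left.
  by right; rewrite asboolT//= /B1 /=; exact/negP.
move=> [[t1 Ut]|]; first by rewrite t1.
by case: asboolP => // U0 /= /negP/negbTE ->.
Qed.

Definition tree_measure : set (borelRn R n) -> \bar R :=
  pushforward (mrestr lebesgue_measure measurable_tree_dom) tree_map.

Let tree_pushforward : {measure set (borelRn R n) -> \bar R} :=
  measure_function_pushforward__canonical__measure_function_Measure
    (mrestr lebesgue_measure measurable_tree_dom) measurable_tree_map.

Let tree_measure0 : tree_measure set0 = 0%E.
Proof. exact: (measure0 tree_pushforward). Qed.

Let tree_measure_ge0 A : (0 <= tree_measure A)%E.
Proof. exact: (measure_ge0 tree_pushforward). Qed.

Let tree_measure_sigma_additive : semi_sigma_additive tree_measure.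
Proof. exact: (@measure_semi_sigma_additive _ _ _ tree_pushforward). Qed.

HB.instance Definition _ := isMeasure.Build _ _ _ tree_measure
  tree_measure0 tree_measure_ge0 tree_measure_sigma_additive.

Lemma lebesgue_tree_itv : lebesgue_measure (tree_itv m) = (m [::])%:E.
Proof.
have := lebesgue_tree_word m [::].
by rewrite (_ : [set t | _] = setT) ?setIT//; apply/seteqP; split.
Qed.

Lemma lebesgue_tree_dom_fin : (lebesgue_measure tree_dom < +oo)%E.
Proof.
apply: (@le_lt_trans _ _ (m [::])%:E); last exact: ltry.
rewrite -lebesgue_tree_itv; apply: le_measure; rewrite ?inE.
- exact: measurable_tree_dom.
- exact: measurable_itv.
- exact: subIsetl.
Qed.

Let tree_measure_finite : fin_num_fun tree_measure.
Proof.
have H : (tree_measure setT < +oo)%E.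
  rewrite (_ : tree_measure setT = lebesgue_measure tree_dom).
    exact: lebesgue_tree_dom_fin.
  by rewrite -[tree_dom]setTI.
by apply: lty_fin_num_fun; exact: H.
Qed.

HB.instance Definition _ := Measure_isFinite.Build _ _ _ tree_measure
  tree_measure_finite.

Lemma integral_tree_measure (f : 'rV[R]_n -> R) : C0 f ->
  (\int[tree_measure]_x (f x)%:E
   = \int[lebesgue_measure]_(t in tree_itv m) (pull_ball f (tree_point t))%:E)%E.
Proof.
move=> Cf; have [B B0 HB] := C0_bounded Cf.
have mf : measurable_fun [set: borelRn R n] (fun x : borelRn R n => (f x)%:E).
  by apply/measurable_EFinP; apply: continuous_borel_measurable; case: Cf.
have intf : (mrestr lebesgue_measure measurable_tree_dom).-integrable
    (tree_map @^-1` setT) ((fun x : borelRn R n => (f x)%:E) \o tree_map).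
  rewrite preimage_setT.
  apply: (@measurable_bounded_integrable _ _ _ _ (f \o tree_map) setT) => //.
  - have H : (mrestr lebesgue_measure measurable_tree_dom setT < +oo)%E.
      by rewrite /mrestr setTI; exact: lebesgue_tree_dom_fin.
    exact: H.
  - apply: (measurableT_comp (f := (f : borelRn R n -> R))); last exact: measurable_tree_map.
    by apply: continuous_borel_measurable; case: Cf.
  - exists B; split; first exact: num_real.
    by move=> M BM x _; exact: (le_trans (HB _) (ltW BM)).
rewrite [LHS](integral_pushforward measurable_tree_map mf intf measurableT).
rewrite preimage_setT in intf *.
have mA := measurable_tree_dom.
rewrite (negligible_integral (measurableC mA) measurableT intf); last first.
  have H : mrestr lebesgue_measure measurable_tree_dom (~` tree_dom) = 0%E.
    by rewrite /mrestr setICl measure0.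
  exact: H.
rewrite setTD setCK (@eq_measure_integral _ _ _ _ lebesgue_measure); last first.
  by move=> A mA' AD; rewrite /= /mrestr setIidl.
rewrite integral_mkcondr; apply: eq_integral => t _.
rewrite /patch /pull_ball /= /tree_map; case: ifPn.
  by rewrite inE /= => t1; rewrite !t1.
by rewrite notin_setE /= => /negP/negbTE ->.
Qed.

Lemma mint_tree_measure_approx (f : 'rV[R]_n -> R) (c : seq bool -> R) (N : nat) (e : R) :
  C0 f ->
  (forall t, `|pull_ball f (tree_point t) - c (tree_word m N t)| <= e) ->
  `|mint tree_measure f - \sum_(u : N.-tuple bool) c u * m u| <= e * m [::].
Proof.
move=> Cf He; rewrite /mint integral_tree_measure//.
have E1 : fine (lebesgue_measure (tree_itv m)) = m [::] by rewrite lebesgue_tree_itv.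
have sz t : size (tree_word m N t) == N by rewrite size_tree_word.
pose lab (t : measurableTypeR R) : N.-tuple bool := Tuple (sz t).
have labE u : [set t | lab t = u] = [set t | tree_word m (size u) t = u].
  apply/seteqP; split => t /=; rewrite size_tuple; first by move=> <-.
  by move=> H; apply: val_inj.
have -> : \sum_(u : N.-tuple bool) c u * m u
    = \sum_(u : N.-tuple bool) c u * fine (lebesgue_measure (tree_itv m `&` [set t | lab t = u])).
  by apply: eq_bigr => u _; rewrite labE lebesgue_tree_word.
rewrite -[X in e * X]E1.
apply: (@integral_label_approx _ _ _ lebesgue_measure (tree_itv m) _ lab _ (fun u => c u)) => //.
- exact: measurable_itv.
- have H : (lebesgue_measure (tree_itv m) < +oo)%E by rewrite lebesgue_tree_itv ltry.
  exact: H.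
- move=> u; rewrite labE; apply: measurableI; first exact: measurable_itv.
  exact: measurable_tree_word.
- apply: (measurable_funS (E := setT)) => //.
  have [cp _] := pull_ball_C0 Cf; move: cp => /continuousP cp.
  apply: (measurability _ (RGenOpens.measurableE R)).
  move=> _ [_ [a [b -> <-]]]; rewrite setTI.
  apply: (@measurable_tree_point (pull_ball f @^-1` `]a, b[%classic)).
  by apply: cp; exact: interval_open.
Qed.

End TreeMeasure.

(** * Weak limits of discrete masses *)

Lemma cvg_bigsum (R : realType) (I : Type) (r : seq I) (f : I -> nat -> R) (l : I -> R) :
  (forall i, f i k @[k --> \oo] --> l i) ->
  \sum_(i <- r) f i k @[k --> \oo] --> \sum_(i <- r) l i.
Proof.
move=> fl; elim: r => [|i r IH].
  by rewrite big_nil; under eq_fun do rewrite big_nil; exact: cvg_cst.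
rewrite big_cons; under eq_fun do rewrite big_cons.
exact: (cvgD (fl i) IH).
Qed.

Section WeakLimit.
Variables (R : realType) (n : nat).

Lemma point_code (x : 'rV[R]_n) : {b : nat -> bool | cube_point R n b = to_ball x}.
Proof.
exact: (cid (cube_point_surj (ltW (norm_to_ball_lt1 x)))).
Qed.

(** A point may have several expansions; any choice serves, since codes only sort the atoms of
    discrete masses into cylinders. *)
Definition code (x : 'rV[R]_n) : nat -> bool := sval (point_code x).

Lemma codeK x : cube_point R n (code x) = to_ball x.
Proof. exact: (svalP (point_code x)). Qed.

Definition cyl_mass (s : dmass R n) (u : seq bool) : R :=
  \sum_(p <- s | prefix_word (code p.2) (size u) == u) p.1.

Lemma cyl_mass_split s u :
  cyl_mass s u = cyl_mass s (false :: u) + cyl_mass s (true :: u).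
Proof.
rewrite /cyl_mass [LHS]big_mkcond [X in _ = X + _]big_mkcond [X in _ = _ + X]big_mkcond.
rewrite -big_split; apply: eq_bigr => p _ /=; rewrite prefix_wordS !eqseq_cons.
by case: (code _ _); case: eqP; rewrite /= ?addr0 ?add0r.
Qed.

Lemma cyl_mass_nil s : cyl_mass s [::] = dmass_total s.
Proof. by rewrite /cyl_mass /dmass_total; apply: eq_bigl => p; rewrite eqxx. Qed.

Lemma cyl_mass_ge0 s u : (forall p, p \in s -> 0 <= p.1) -> 0 <= cyl_mass s u.
Proof. by move=> s0; rewrite /cyl_mass big_seq_cond sumr_ge0// => p /andP[/s0]. Qed.

Lemma cyl_mass_le_total s u :
  (forall p, p \in s -> 0 <= p.1) -> cyl_mass s u <= dmass_total s.
Proof.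
move=> s0; rewrite /cyl_mass /dmass_total big_mkcond /= !big_seq.
by apply: ler_sum => p /s0; case: ifP.
Qed.

Lemma dmass_int_cyl_approx s (f : 'rV[R]_n -> R) (c : seq bool -> R) N e :
  (forall p, p \in s -> 0 <= p.1) ->
  (forall x, `|f x - c (prefix_word (code x) N)| <= e) ->
  `|dmass_int s f - \sum_(u : N.-tuple bool) c u * cyl_mass s u|
  <= e * dmass_total s.
Proof.
move=> s0 He; have -> : \sum_(u : N.-tuple bool) c u * cyl_mass s u
    = \sum_(p <- s) p.1 * c (prefix_word (code p.2) N).
  under eq_bigr do rewrite /cyl_mass big_mkcond mulr_sumr.
  rewrite exchange_big /=; apply: eq_bigr => p _.
  have sz : size (prefix_word (code p.2) N) == N by rewrite size_prefix_word.
  rewrite (bigD1 (Tuple sz))//= size_prefix_word eqxx big1 ?addr0 1?mulrC// => u.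
  rewrite size_tuple => un; case: eqP => [E|]; last by rewrite mulr0.
  by case/eqP: un; apply: val_inj.
rewrite /dmass_int -sumrB /dmass_total mulr_sumr (le_trans (ler_norm_sum _ _ _))//.
rewrite !big_seq; apply: ler_sum => p /s0 p0.
by rewrite -mulrBr normrM ger0_norm// mulrC ler_wpM2r.
Qed.

(** Nonnegativity and additivity of the cylinder masses pass to the limit, giving a mass tree. The
    integrals against [s k] and against the tree measure are then close to the same finite sum over
    words of length [N], with [cyl_mass (s k) u] and [m u] as respective masses. *)
Lemma weak_limit_of_cyl_masses (s : nat -> dmass R n) (m : seq bool -> R) :
  (forall k p, p \in s k -> 0 <= p.1) ->
  (forall u, cyl_mass (s k) u @[k --> \oo] --> m u) ->
  exists nu : fmeasure R n,
    forall f, C0 f -> dmass_int (s k) f @[k --> \oo] --> mint nu f.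
Proof.
move=> s0 cm.
have m_ge0 u : 0 <= m u.
  apply: (cvgr_to_ge (cm u)); apply: nearW => k.
  by apply: cyl_mass_ge0 => p; exact: s0.
have m_split u : m u = m (false :: u) + m (true :: u).
  apply: (cvg_unique (@Rhausdorff R) (cm u)) => /=.
  under eq_fun do rewrite cyl_mass_split.
  exact: (cvgD (cm (false :: u)) (cm (true :: u))).
pose M := MassTree m_ge0 m_split.
exists (@tree_measure R n M : fmeasure R n) => f Cf.
apply/cvgrPdist_le => e e0.
(* Three errors must fit into [e = e1 * K]: [e1 * m [::]] for the limit, [e1 * (m [::] + 1)] for
   [s k] with [k] large, and [e1] between the two sums. *)
pose K := 2 * (m [::] + 1) + 1.
have K0 : 0 < K by have := m_ge0 [::]; rewrite /K; lra.
pose e1 := e / K; have e10 : 0 < e1 by rewrite divr_gt0.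
have [d d0 Hd] := C0_unif_continuous (pull_ball_C0 Cf) e10.
have d20 : 0 < d / 2 by rewrite divr_gt0.
have [N0 hN0] := half_exp_small d20; pose N := (N0 * n)%N.
(* The sample point of a cylinder continues its word by [false]; [rev] restores the reading
   order. *)
pose c u := pull_ball f (cube_point R n (nth false (rev u))).
have cE b : `|pull_ball f (cube_point R n b) - c (prefix_word b N)| <= e1.
  apply/ltW/Hd; apply: (@le_lt_trans _ _ (2 * 2^-1 ^+ N0)); last by lra.
  apply: cube_point_close; rewrite -/N.
  by have := prefix_word_nth (prefix_word b N); rewrite size_prefix_word => ->.
have A1 : `|mint (@tree_measure R n M) f - \sum_(u : N.-tuple bool) c u * m u| <= e1 * m [::].
  apply: (@mint_tree_measure_approx _ _ M) => // t.
  by rewrite -prefix_tree_branch; exact: cE.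
have A2 k : `|dmass_int (s k) f - \sum_(u : N.-tuple bool) c u * cyl_mass (s k) u|
    <= e1 * dmass_total (s k).
  apply: dmass_int_cyl_approx => [p|x]; first exact: s0.
  by rewrite -(pull_ballK f) -codeK; exact: cE.
have A3 : \sum_(u : N.-tuple bool) c u * cyl_mass (s k) u @[k --> \oo]
    --> \sum_(u : N.-tuple bool) c u * m u.
  by apply: cvg_bigsum => u; apply: cvgMl_tmp; exact: cm.
near=> k.
have B3 : `|\sum_(u : N.-tuple bool) c u * m u - \sum_(u : N.-tuple bool) c u * cyl_mass (s k) u| <= e1.
  by near: k; move/cvgrPdist_le : A3; apply.
have B4 : dmass_total (s k) <= m [::] + 1.
  have : `|m [::] - cyl_mass (s k) [::]| <= 1.
    by near: k; move/cvgrPdist_le : (cm [::]); apply.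
  by rewrite cyl_mass_nil ler_norml => /andP[+ _]; lra.
have B2 : e1 * dmass_total (s k) <= e1 * (m [::] + 1) by rewrite ler_pM2l.
have eK : e = e1 * K by rewrite /e1 divfK// gt_eqF.
have := A2 k; move: A1 B3; rewrite !ler_norml => /andP[a1 a2] /andP[a3 a4] /andP[a5 a6].
rewrite eK /K; nra.
Unshelve. all: by end_near.
Qed.

End WeakLimit.

(** * Extraction of a common convergent subsequence *)

Section CommonSubsequence.
Variable R : realType.

Lemma ultra_limit (U : set_system nat) (x : nat -> R) (C : R) :
  UltraFilter U -> (forall k, `|x k| <= C) ->
  exists l, forall e, 0 < e -> U [set k | `|x k - l| < e].
Proof.
move=> UU xC; have PU := @ultra_proper _ _ UU.
have H : (x @ U) `[- C, C]%classic.
  by apply: (@filterS _ U _ setT) filterT => k _ /=; rewrite in_itv /= -ler_norml.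
have [l [_ cl]] := @segment_compact R (- C) C (x @ U) (fmap_proper_filter x PU) H.
exists l => e e0.
have [//|Hc] := in_ultra_setVsetC [set k | `|x k - l| < e] UU; exfalso.
have Hb : U (x @^-1` (~` ball l e)).
  apply: (@filterS _ U _ _ _ _ Hc) => k /= Hk Hb; apply: Hk.
  by have : `|l - x k| < e := Hb; rewrite distrC.
by have [y [/= Hy]] := cl (~` ball l e) (ball l e) Hb (nbhsx_ballx _ _ e0).
Qed.

(** An ultrafilter finer than the neighbourhoods of infinity selects all the limits at once, in
    place of iterated extractions. Stage [j] constrains only the finitely many indices with
    [pickle i < j]; a finite intersection of sets of [U] is again in [U], hence has members beyond
    any bound. *)
Lemma common_subsequence (I : countType) (x : I -> nat -> R) (C : R) :
  (forall i k, `|x i k| <= C) ->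
  exists (l : I -> R) (h : nat -> nat), (forall j, (h j < h j.+1)%N) /\
    forall i, x i (h j) @[j --> \oo] --> l i.
Proof.
move=> xC; have [U [UU sU]] := @ultraFilterLemma nat \oo _.
have PU := @ultra_proper _ _ UU.
have /choice[l lP] : forall i, exists l, forall e, 0 < e -> U [set k | `|x i k - l| < e].
  by move=> i; exact: ultra_limit (xC i).
have Ufin e j : 0 < e -> U [set k | forall i, (pickle i < j)%N -> `|x i k - l i| < e].
  move=> e0; elim: j => [|j IH]; first by apply: filterE.
  have [[i ij]|Ni] := pselect (exists i : I, pickle i = j).
    apply: filterS (filterI IH (lP i e e0)) => k [Hk Hi] i'; rewrite ltnS leq_eqVlt.
    case/predU1P => [|/Hk//]; rewrite -ij => /(pcan_inj pickleK) -> //.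
  apply: filterS IH => k Hk i; rewrite ltnS leq_eqVlt => /predU1P[ij|/Hk//].
  by exfalso; apply: Ni; exists i.
have step (Nj : nat * nat) : exists k, (Nj.1 < k)%N /\
    forall i, (pickle i < Nj.2)%N -> `|x i k - l i| < Nj.2.+1%:R^-1.
  have e0 : 0 < Nj.2.+1%:R^-1 :> R by rewrite invr_gt0.
  have Nk : U [set k | (Nj.1 < k)%N] by apply: sU; exists Nj.1.+1.
  by have [k [Hk Nk']] := filter_ex (filterI (Ufin _ Nj.2 e0) Nk); exists k.
have [nxt nxtP] := choice step.
pose h := fix h j := if j is j'.+1 then nxt (h j', j) else 0%N.
exists l, h; split; first by move=> j; exact: (nxtP (h j, j.+1)).1.
move=> i; apply/cvgrPdist_lt => e e0.
have [N0 _ HN0] := near_infty_natSinv_lt (PosNum e0).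
exists (maxn N0 (pickle i).+1) => // -[|j] /=; first by rewrite geq_max ltn0 andbF.
rewrite geq_max => /andP[Nj ij]; rewrite distrC.
exact: lt_trans ((nxtP (h j, j.+1)).2 i ij) (HN0 _ Nj).
Qed.

End CommonSubsequence.

(** * Pairing with a difference of finite measures *)

Section ChargePairing.
Variables (R : realType) (n : nat).

Lemma fin_num_subr_eq (x y z w : \bar R) : z \is a fin_num -> w \is a fin_num ->
  x \is a fin_num -> y \is a fin_num ->
  (x - y = z - w)%E -> (z + y = x + w)%E.
Proof.
case: x y z w => [x||] // [y||] // [z||] // [w||] // _ _ _ _ [H].
by rewrite -!EFinD; congr EFin; lra.
Qed.

Definition charge_diff (n1 n2 : fmeasure R n) : charge_on R n :=
  cadd (charge_of_finite_measure n1) (copp (charge_of_finite_measure n2)).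

(** The Jordan parts [P], [N] of the difference may differ from [n1], [n2], but [P + n2 = n1 + N] as
    measures, and this can be integrated. *)
Lemma charge_int_diff (n1 n2 : fmeasure R n) (f : 'rV[R]_n -> R) : C0 f ->
  charge_int (charge_diff n1 n2) f = mint n1 f - mint n2 f.
Proof.
move=> Cf; rewrite /charge_int /mint.
set P := jordan_pos _; set N := jordan_neg _.
have iP := @C0_integrable _ _ P _ Cf; have iN := @C0_integrable _ _ N _ Cf.
have i1 := @C0_integrable _ _ n1 _ Cf; have i2 := @C0_integrable _ _ n2 _ Cf.
have E : (\int[P]_x (f x)%:E + \int[n2]_x (f x)%:E
    = \int[n1]_x (f x)%:E + \int[N]_x (f x)%:E)%E.
  rewrite -(integral_measure_add measurableT iP i2).
  rewrite -(integral_measure_add measurableT i1 iN).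
  apply: eq_measure_integral => A mA _.
  suff : measure_add P n2 A = measure_add n1 N A by [].
  rewrite !measure_addE.
  have : (n1 A - n2 A = P A - N A)%E.
    transitivity (charge_diff n1 n2 A); first by [].
    by rewrite (jordan_decomp (svalP (hahnN (charge_diff n1 n2))) mA) /cadd /= cscaleN1.
  have fP : P A \is a fin_num by exact: fin_num_measure.
  have fN : N A \is a fin_num by exact: fin_num_measure.
  have f1 : n1 A \is a fin_num by exact: fin_num_measure.
  have f2 : n2 A \is a fin_num by exact: fin_num_measure.
  exact: fin_num_subr_eq.
move: E; rewrite -(fineK (integrable_fin_num measurableT iP)).
rewrite -(fineK (integrable_fin_num measurableT iN)).
rewrite -(fineK (integrable_fin_num measurableT i1)).
rewrite -(fineK (integrable_fin_num measurableT i2)) => -[] /= H; lra.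
Qed.

End ChargePairing.

(** * Compactness of fluxes *)

Section SegmentSums.
Variables (R : realType) (n : nat).
Local Notation V := 'rV[R]_n.
Implicit Types (phi : V -> V) (a b : V).

Lemma row_coord_continuous (i : 'I_n) : continuous (fun x : V => x ord0 i).
Proof. exact: coord_continuous. Qed.

Lemma C0v_coord phi (i : 'I_n) : C0v phi -> C0 (fun x => phi x ord0 i).
Proof.
move=> [cphi phi0]; split.
  move=> x; apply: (@continuous_comp _ _ _ phi (fun y : V => y ord0 i)); first exact: cphi.
  exact: row_coord_continuous.
move=> e /phi0[r Hr]; exists r => x /Hr; exact: le_lt_trans (mx_norm_ge_coord _ _).
Qed.

Lemma measurable_segment (f : V -> R) a b : continuous f ->
  measurable_fun setT (fun s : measurableTypeR R => f (a + s *: b)).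
Proof.
move=> cf; apply: continuous_measurable_fun => s.
apply: (@continuous_comp R V R (fun s => a + s *: b) f); last exact: cf.
apply: (@continuousD _ _ _ (fun=> a) (fun s : R => s *: b)); first exact: cst_continuous.
by apply: cvgZr_tmp; exact: cvg_id.
Qed.

Definition pos_part (r : R) : R := Num.max r 0.

Lemma pos_partB r : pos_part r - pos_part (- r) = r.
Proof. by rewrite /pos_part; case: (leP r 0); case: (leP (- r) 0); lra. Qed.

Lemma pos_part_ge0 r : 0 <= pos_part r.
Proof. by rewrite /pos_part le_max lexx orbT. Qed.

Lemma pos_part_le_norm r : pos_part r <= `|r|.
Proof. by rewrite /pos_part ge_max ler_norm normr_ge0. Qed.

Definition sample (K : nat) a b (l : nat) : V := a + (l%:R / K%:R) *: (b - a).

(** Each of the [K] steps along the segment is shorter than [d]; the factor [n] is the price of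
    bounding a dot product by sup norms. *)
Lemma seg_int_approx phi a b (K : nat) (d e : R) : C0v phi -> (0 < K)%N -> 0 <= e ->
  (forall x y, `|x - y| < d -> `|phi x - phi y| < e) -> `|b - a| < d * K%:R ->
  `|seg_int phi a b
    - \sum_(i < n) \sum_(l < K) ((b - a) ord0 i / K%:R) * phi (sample K a b l) ord0 i|
  <= n%:R * e * `|b - a|.
Proof.
move=> Cphi K0 e0 Hd ab; have KR : 0 < K%:R :> R by rewrite ltr0n.
pose h (s : R) := dotp (phi (a + s *: (b - a))) (b - a).
have mh : measurable_fun setT (h : measurableTypeR R -> R).
  rewrite /h /dotp; apply: measurable_sum => i; apply: measurable_funM => //.
  by apply: (@measurable_segment (fun x => phi x ord0 i)); case: (C0v_coord i Cphi).
(* Without the endpoint 1, the interval is partitioned by [K] half-open cells of equal length. *)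
have -> : seg_int phi a b = fine (\int[lebesgue_measure]_(s in `[0%R, 1%R[) (h s)%:E)%E.
  rewrite /seg_int integral_itv_bndo_bndc//.
  by apply/measurable_EFinP; exact: measurable_funS mh.
case: K K0 ab KR => // K _ ab KR.
pose lab (s : measurableTypeR R) : 'I_K.+1 := inord (Num.truncn (s * K.+1%:R)).
have labP s : 0 <= s < 1 -> (lab s)%:R <= s * K.+1%:R < (lab s).+1%:R.
  move=> /andP[s0 s1]; have q0 : 0 <= s * K.+1%:R by rewrite mulr_ge0.
  have /andP[l1 l2] := truncn_itv q0.
  rewrite /lab inordK ?l1 ?l2// -(ltr_nat R); apply: (le_lt_trans l1).
  by rewrite gtr_pMl.
have labE l : `[0%R, 1%R[%classic `&` [set s | lab s = l]
    = `[l%:R / K.+1%:R, l.+1%:R / K.+1%:R[%classic.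
  apply/seteqP; split => s /=; rewrite !in_itv /=.
    by move=> [/labP + ls]; rewrite ls ler_pdivrMr// ltr_pdivlMr//.
  rewrite ler_pdivrMr// ltr_pdivlMr// => /andP[l1 l2].
  have s0 : 0 <= s by rewrite -(pmulr_lge0 _ KR); apply: le_trans l1.
  have s1 : s < 1.
    rewrite -(ltr_pM2r KR) mul1r; apply: (lt_le_trans l2).
    by rewrite ler_nat ltn_ord.
  split; first by rewrite s0.
  apply: val_inj; rewrite /lab /= inordK (truncn_def (n := l)) ?l1//.
pose c (l : 'I_K.+1) : R := h (l%:R / K.+1%:R).
have -> : \sum_(i < n) \sum_(l < K.+1) (b - a) ord0 i / K.+1%:R * phi (sample K.+1 a b l) ord0 i
    = \sum_(l < K.+1) c l
        * fine (lebesgue_measure (`[0%R, 1%R[%classic `&` [set s | lab s = l])).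
  rewrite exchange_big /=; apply: eq_bigr => l _.
  have -> : fine (lebesgue_measure (`[0%R, 1%R[%classic `&` [set s | lab s = l])) = K.+1%:R^-1.
    rewrite labE lebesgue_measure_itv /= lte_fin ltr_pM2r ?invr_gt0// ltr_nat ltnSn.
    by rewrite -EFinB /= -mulrBl -natrB ?subSnn ?mul1r.
  rewrite /c /h /dotp mulr_suml; apply: eq_bigr => i _.
  by rewrite -/(sample K.+1 a b l); ring.
have E1 : fine (lebesgue_measure (`[0%R, 1%R[%classic : set R)) = 1.
  by rewrite lebesgue_measure_itv /= lte_fin ltr01 -EFinB /= subr0.
have -> : n%:R * e * `|b - a| = n%:R * e * `|b - a|
    * fine (lebesgue_measure (`[0%R, 1%R[%classic : set R)) by rewrite E1 mulr1.
apply: (@integral_label_approx _ _ _ lebesgue_measure `[0%R, 1%R[%classic _ lab h c) => //.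
- have H : (lebesgue_measure (`[0%R, 1%R[%classic : set R) < +oo)%E.
    by rewrite lebesgue_measure_itv /= lte_fin ltr01 -EFinB ltry.
  exact: H.
- by move=> l; rewrite labE; exact: measurable_itv.
- exact: measurable_funS mh.
- move=> s /=; rewrite in_itv /= => s01; have /andP[l1 l2] := labP _ s01.
  set l := lab s in l1 l2 *.
  have cl : `|(a + s *: (b - a)) - (a + (l%:R / K.+1%:R) *: (b - a))| < d.
    rewrite opprD addrACA subrr add0r -scalerBl normrZ.
    have s1 : `|s - l%:R / K.+1%:R| <= K.+1%:R^-1.
      rewrite ger0_norm; last by rewrite subr_ge0 ler_pdivrMr.
      rewrite -(ler_pM2r KR) mulrBl divfK ?gt_eqF// mulVf ?gt_eqF//.
      by move: l2; rewrite -natr1; lra.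
    apply: (le_lt_trans (ler_wpM2r (normr_ge0 _) s1)).
    by rewrite mulrC ltr_pdivrMr.
  rewrite /c /h /dotp -sumrB.
  apply: (@le_trans _ _ (\sum_(i < n) e * `|b - a|)).
    apply: (le_trans (ler_norm_sum _ _ _)); apply: ler_sum => i _.
    rewrite -mulrBl normrM ler_pM ?mx_norm_ge_coord//.
    have := Hd _ _ cl => /ltW; apply: le_trans.
    have := mx_norm_ge_coord (phi (a + s *: (b - a)) - phi (a + (l%:R / K.+1%:R) *: (b - a))) i.
    by rewrite !mxE.
  by rewrite sumr_const card_ord -[leRHS]mulrA mulr_natl.
Qed.

(** [sg] is meant to be 1 or -1 and selects the positive or negative part of the [i]-th flux
    component, so that a signed component becomes a difference of two discrete masses. *)
Definition edge_sample (K : nat) (i : 'I_n) (sg : R) (e : (V * V) * R) (l : nat) : R * V :=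
  (pos_part (sg * (e.2 * ((e.1.2 - e.1.1) ord0 i / K%:R))), sample K e.1.1 e.1.2 l).

Definition flux_sample K i sg (G : graph R n) : dmass R n :=
  [seq edge_sample K i sg e l | e <- gedges G, l <- index_iota 0 K].

Lemma flux_sample_ge0 K i sg G p : p \in flux_sample K i sg G -> 0 <= p.1.
Proof. by move=> /allpairsP[[e l] [_ _ ->]] /=; exact: pos_part_ge0. Qed.

Lemma dmass_int_flux_sample K i sg G (f : V -> R) :
  dmass_int (flux_sample K i sg G) f = \sum_(e <- gedges G) \sum_(l < K)
    pos_part (sg * (e.2 * ((e.1.2 - e.1.1) ord0 i / K%:R))) * f (sample K e.1.1 e.1.2 l).
Proof.
rewrite /dmass_int /flux_sample big_allpairs_dep /=; apply: eq_bigr => e _.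
by rewrite big_mkord.
Qed.

Lemma flux_sample_total K i sg G (C : R) : (0 < K)%N -> `|sg| = 1 ->
  (forall e, e \in gedges G -> 0 <= e.2) ->
  \sum_(e <- gedges G) e.2 * `|e.1.2 - e.1.1| <= C ->
  dmass_total (flux_sample K i sg G) <= C.
Proof.
move=> K0 sg1 G0; apply: le_trans; have KR : 0 < K%:R :> R by rewrite ltr0n.
have -> : dmass_total (flux_sample K i sg G) = dmass_int (flux_sample K i sg G) (fun=> 1).
  by apply: eq_bigr => p _; rewrite mulr1.
rewrite dmass_int_flux_sample big_seq [leRHS]big_seq; apply: ler_sum => e eG.
rewrite sumr_const card_ord mulr1 -[leLHS]mulr_natr -ler_pdivlMr//.
apply: (le_trans (pos_part_le_norm _)); rewrite normrM sg1 mul1r normrM ger0_norm ?G0//.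
rewrite -mulrA ler_wpM2l ?G0// normrM [`|_^-1|]ger0_norm ?invr_ge0 ?ler0n//.
by rewrite ler_pM2r ?invr_gt0// mx_norm_ge_coord.
Qed.

Lemma flux_pair_approx G phi (K : nat) (d e C : R) : C0v phi -> (0 < K)%N -> 0 <= e ->
  (forall x y, `|x - y| < d -> `|phi x - phi y| < e) ->
  (forall q, q \in gedges G -> 0 <= q.2 /\ `|q.1.2 - q.1.1| < d * K%:R) ->
  \sum_(q <- gedges G) q.2 * `|q.1.2 - q.1.1| <= C ->
  `|flux_pair G phi - \sum_(i < n) (dmass_int (flux_sample K i 1 G) (fun x => phi x ord0 i)
      - dmass_int (flux_sample K i (-1) G) (fun x => phi x ord0 i))|
  <= n%:R * e * C.
Proof.
move=> Cphi K0 e0 Hd HG HC.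
have -> : \sum_(i < n) (dmass_int (flux_sample K i 1 G) (fun x => phi x ord0 i)
      - dmass_int (flux_sample K i (-1) G) (fun x => phi x ord0 i))
    = \sum_(q <- gedges G) q.2 * \sum_(i < n) \sum_(l < K)
        ((q.1.2 - q.1.1) ord0 i / K%:R) * phi (sample K q.1.1 q.1.2 l) ord0 i.
  under [RHS]eq_bigr do rewrite mulr_sumr.
  rewrite [RHS]exchange_big /=; apply: eq_bigr => i _.
  rewrite !dmass_int_flux_sample -sumrB; apply: eq_bigr => q _.
  rewrite -sumrB mulr_sumr; apply: eq_bigr => l _.
  by rewrite -mulrBl mul1r mulN1r pos_partB [RHS]mulrA.
rewrite /flux_pair -sumrB; apply: (le_trans (ler_norm_sum _ _ _)).
apply: (@le_trans _ _ (\sum_(q <- gedges G) n%:R * e * (q.2 * `|q.1.2 - q.1.1|))).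
  rewrite big_seq [leRHS]big_seq; apply: ler_sum => q /HG[q0 qd].
  rewrite -mulrBr normrM ger0_norm// mulrCA ler_wpM2l//.
  by apply: (seg_int_approx Cphi K0 e0 Hd).
by rewrite -mulr_sumr ler_wpM2l// mulr_ge0.
Qed.

Lemma flux_compactness (G : nat -> graph R n) (C : R) :
  (forall k q, q \in gedges (G k) -> 0 <= q.2) ->
  (forall k, \sum_(q <- gedges (G k)) q.2 * `|q.1.2 - q.1.1| <= C) ->
  exists (h : nat -> nat) (F : vmeasure R n), (forall j, (h j < h j.+1)%N) /\
    forall phi, C0v phi -> flux_pair (G (h j)) phi @[j --> \oo] --> vpair F phi.
Proof.
move=> G0 GC.
have Cge0 : 0 <= C.
  apply: le_trans (GC 0%N); rewrite big_seq sumr_ge0// => q /G0 q0.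
  by rewrite mulr_ge0.
(* The edges of [G k] may grow with [k]; this count makes every step of every edge shorter than
   [1 / (k + 1)]. *)
pose K k := ((Num.truncn (\sum_(q <- gedges (G k)) `|q.1.2 - q.1.1|)).+1 * k.+1)%N.
have K0 k : (0 < K k)%N by rewrite muln_gt0.
pose sgn (sb : bool) : R := if sb then 1 else -1.
have sgn1 sb : `|sgn sb| = 1 by case: sb; rewrite /sgn ?normrN normr1.
pose s (ib : 'I_n * bool) k := flux_sample (K k) ib.1 (sgn ib.2) (G k).
have s0 ib k p : p \in s ib k -> 0 <= p.1 by exact: flux_sample_ge0.
pose x (iu : ('I_n * bool) * seq bool) k := cyl_mass (s iu.1 k) iu.2.
have xC iu k : `|x iu k| <= C.
  rewrite ger0_norm; last by apply: cyl_mass_ge0 => p; exact: s0.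
  apply: le_trans (cyl_mass_le_total _ _) _; first by move=> p; exact: s0.
  by apply: flux_sample_total => // q; exact: G0.
have [l [h [hS hl]]] := common_subsequence xC.
have hj j : (j <= h j)%N.
  by elim: j => // j IH; apply: leq_ltn_trans (hS j).
have /choice[nu nuP] (ib : 'I_n * bool) : exists nu : fmeasure R n,
    forall f, C0 f -> dmass_int (s ib (h k)) f @[k --> \oo] --> mint nu f.
  apply: (@weak_limit_of_cyl_masses _ _ (fun k => s ib (h k)) (fun u => l (ib, u))).
    by move=> k p; exact: s0.
  by move=> u; exact: (hl (ib, u)).
exists h, (fun i => charge_diff (nu (i, true)) (nu (i, false))); split => // phi Cphi.
have vE : vpair (fun i => charge_diff (nu (i, true)) (nu (i, false))) phi
    = \sum_(i < n) (mint (nu (i, true)) (fun x => phi x ord0 i)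
                    - mint (nu (i, false)) (fun x => phi x ord0 i)).
  by apply: eq_bigr => i _; apply: charge_int_diff; exact: C0v_coord.
have L : \sum_(i < n) (dmass_int (s (i, true) (h j)) (fun x => phi x ord0 i)
      - dmass_int (s (i, false) (h j)) (fun x => phi x ord0 i)) @[j --> \oo]
    --> vpair (fun i => charge_diff (nu (i, true)) (nu (i, false))) phi.
  rewrite vE; apply: cvg_bigsum => i.
  by apply: cvgB; apply: nuP; exact: C0v_coord.
(* Sampling costs [n * (e / D) * C] and the convergence of the sampled pairings [e / D], together
   [e]. *)
apply/cvgrPdist_le => e e0; pose D := n%:R * C + 1.
have D0 : 0 < D by rewrite ltr_wpDl// mulr_ge0.
have e10 : 0 < e / D by rewrite divr_gt0.
have [cphi vphi] := Cphi.
have [d d0 Hd] := unif_continuous_vanishing cphi vphi e10.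
have [N0 _ HN0] := near_infty_natSinv_lt (PosNum d0).
near=> j.
have B1 : `|vpair (fun i => charge_diff (nu (i, true)) (nu (i, false))) phi
   - \sum_(i < n) (dmass_int (s (i, true) (h j)) (fun x => phi x ord0 i)
      - dmass_int (s (i, false) (h j)) (fun x => phi x ord0 i))| <= e / D.
  by near: j; move/cvgrPdist_le : L; apply.
have N0j : (N0 <= h j)%N by apply: leq_trans (hj j); near: j; exists N0.
have B2 := @flux_pair_approx (G (h j)) phi (K (h j)) d (e / D) C Cphi (K0 _) (ltW e10) Hd.
have eD : e = (e / D) * (n%:R * C) + e / D.
  by rewrite -[X in _ + X]mulr1 -mulrDr divfK// gt_eqF.
rewrite distrC [leRHS]eD.
set S := \sum_(i < n) _ in B1.
rewrite -[flux_pair _ _](subrK S) -addrA (le_trans (ler_normD _ _))// lerD//; last first.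
  by rewrite distrC.
rewrite [leRHS](_ : _ = n%:R * (e / D) * C); last by ring.
apply: B2 => // q qG; split; first exact: G0 qG.
have HS : `|q.1.2 - q.1.1| <= \sum_(q <- gedges (G (h j))) `|q.1.2 - q.1.1|.
  by rewrite (big_rem q)//= lerDl sumr_ge0.
have S0 : 0 <= \sum_(q <- gedges (G (h j))) `|q.1.2 - q.1.1| by rewrite sumr_ge0.
have /andP[_ T2] := truncn_itv S0.
apply: (le_lt_trans HS); rewrite /K natrM mulrCA.
apply: (lt_le_trans T2); rewrite ler_peMr// ltW//.
by have := HN0 _ N0j; rewrite /= -[_^-1]mul1r ltr_pdivrMr.
Unshelve. all: by end_near.
Qed.

End SegmentSums.

(** * Weak form of the flux balance *)

Section Balance.
Variables (R : realType) (n : nat).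
Local Notation V := 'rV[R]_n.
Implicit Types (sp sm : dmass R n) (E : seq ((V * V) * R)) (G : graph R n).

(** Kirchhoff's law tested against arbitrary functions. It mentions no vertex list, and cutting at a
    level amounts to multiplying [chi] by an indicator. *)
Definition balanced sp sm E := forall chi : V -> R,
  dmass_int sp chi + \sum_(e <- E) e.2 * chi e.1.2
  = dmass_int sm chi + \sum_(e <- E) e.2 * chi e.1.1.

Lemma sum_fibers (I : eqType) (s : seq I) (h : I -> V) (a : I -> R)
    (vs : seq V) (chi : V -> R) :
  uniq vs -> (forall i, i \in s -> h i \in vs) ->
  \sum_(v <- vs) (\sum_(i <- s | h i == v) a i) * chi v
  = \sum_(i <- s) a i * chi (h i).
Proof.
move=> uvs hvs; under eq_bigr do rewrite mulr_suml big_mkcond.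
rewrite exchange_big /=; apply: eq_big_seq => i si.
rewrite (bigD1_seq (h i)) ?hvs//= eqxx big1 ?addr0// => v vi.
by rewrite eq_sym (negbTE vi).
Qed.

Lemma dflux_balanced sp sm G : is_dflux sp sm G -> balanced sp sm (gedges G).
Proof.
move=> [_ _ HE Hv] chi.
pose vs := undup (gvert G ++ dmass_spt sp ++ dmass_spt sm).
have vsP v : (v \in vs) = (v \in gvert G ++ dmass_spt sp ++ dmass_spt sm).
  exact: mem_undup.
have uvs : uniq vs by exact: undup_uniq.
rewrite /dmass_int -(@sum_fibers _ sp snd fst vs)//; last first.
  by move=> p ps; rewrite vsP !mem_cat /dmass_spt (map_f snd ps) ?orbT.
rewrite -(@sum_fibers _ sm snd fst vs)//; last first.
  by move=> p ps; rewrite vsP !mem_cat /dmass_spt (map_f snd ps) ?orbT.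
rewrite -(@sum_fibers _ (gedges G) (fun e => e.1.2) (fun e => e.2) vs)//; last first.
  by move=> e /HE[_ _ _ eG]; rewrite vsP mem_cat eG.
rewrite -(@sum_fibers _ (gedges G) (fun e => e.1.1) (fun e => e.2) vs)//; last first.
  by move=> e /HE[_ _ eG _]; rewrite vsP mem_cat eG.
rewrite -!big_split; apply: eq_big_seq => v; rewrite vsP => /Hv /= H.
by rewrite -!mulrDl; congr (_ * _).
Qed.

Lemma dmass_int_pred1 (s : dmass R n) v :
  dmass_int s (fun x => (x == v)%:R) = dmass_at s v.
Proof.
rewrite /dmass_int /dmass_at [RHS]big_mkcond; apply: eq_bigr => p _.
by case: eqP; rewrite ?mulr1 ?mulr0.
Qed.

Lemma balanced_dflux sp sm G : balanced sp sm (gedges G) ->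
  uniq (map fst (gedges G)) ->
  (forall e, e \in gedges G ->
     [/\ e.1.1 != e.1.2, 0 <= e.2, e.1.1 \in gvert G & e.1.2 \in gvert G]) ->
  is_dflux sp sm G.
Proof.
move=> B uE HE; split => //.
  have := B (fun=> 1); rewrite /dmass_int /dmass_total => H.
  apply: (addIr (\sum_(e <- gedges G) e.2 * 1)).
  by move: H; under eq_bigr do rewrite mulr1; under [in RHS]eq_bigr do rewrite mulr1.
move=> v _; have := B (fun x => (x == v)%:R); rewrite !dmass_int_pred1 => H.
rewrite [X in _ + X = _]big_mkcond [X in _ = _ + X]big_mkcond /=.
have E (u : (V * V) * R -> V) : \sum_(e <- gedges G) (if u e == v then e.2 else 0)
    = \sum_(e <- gedges G) e.2 * (u e == v)%:R.
  by apply: eq_bigr => e _; case: eqP; rewrite ?mulr1 ?mulr0.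
by rewrite (E (fun e => e.1.2)) (E (fun e => e.1.1)).
Qed.

End Balance.

(** * Linear lower bound for the transportation cost *)

Section Cost.
Variables (R : realType) (tau : R -> R).
Hypothesis tc : transportation_cost tau.

Lemma tc_ge0 w : 0 <= w -> 0 <= tau w.
Proof.
case: tc => t0 tp _ _ _; rewrite le_eqVlt => /predU1P[<-|/tp/ltW//].
by rewrite t0.
Qed.

Lemma tc_natmul w k : 0 <= w -> tau (w *+ k) <= tau w *+ k.
Proof.
move=> w0; case: tc => t0 _ _ ts _; elim: k => [|k IH]; first by rewrite !mulr0n t0.
rewrite !mulrS; apply: (le_trans (ts _ _ w0 (mulrn_wge0 _ w0))).
by rewrite lerD2l.
Qed.

(** Subadditivity: [truncn (M / w) + 1] copies of [w] reach [M] and overshoot it by at most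
    [w <= M], whence the factor 2. *)
Lemma tc_linear_bound w M : 0 <= w <= M -> 0 < M ->
  w * tau M <= 2 * M * tau w.
Proof.
move=> /andP[w0 wM] M0; case: (tc) => t0 tp tn ts _.
move: w0; rewrite le_eqVlt => /predU1P[<-|w0]; first by rewrite t0 mul0r mulr0.
have q0 : 0 <= M / w by rewrite divr_ge0// ltW.
have /andP[k1 k2] := truncn_itv q0; set k := Num.truncn _ in k1 k2.
have Mk : M <= w *+ k.+1.
  by rewrite -mulr_natl; move: k2; rewrite ltr_pdivrMr// => /ltW.
have kM : w *+ k.+1 <= 2 * M.
  move: k1; rewrite ler_pdivlMr// mulrS -mulr_natl => k1; lra.
have H1 : tau M <= tau w *+ k.+1.
  by apply: (le_trans (tn _ _ (ltW M0) Mk)); apply: tc_natmul; exact: ltW.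
apply: (@le_trans _ _ (w * (tau w *+ k.+1))); first by rewrite ler_pM2l.
by rewrite mulrnAr -mulrnAl ler_wpM2r// tc_ge0// ltW.
Qed.

End Cost.

(** * Removal of circulations *)

Section Circulation.
Variables (R : realType) (T : eqType).
Implicit Types (K : seq (T * T)) (w g : T * T -> R) (chi : T -> R).

(** The net inflow of [w] tested against [chi]; a circulation is a weight whose flow is 0 for every
    [chi]. *)
Definition flow K w chi : R := \sum_(q <- K) w q * (chi q.2 - chi q.1).

Lemma flow_add K w g t chi :
  flow K (fun q => w q + t * g q) chi = flow K w chi + t * flow K g chi.
Proof.
rewrite /flow mulr_sumr -big_split /=; apply: eq_bigr => q _.
by rewrite mulrDl mulrA.
Qed.

Lemma flow_pred1 K q0 chi : uniq K -> q0 \in K ->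
  flow K (fun q => (q == q0)%:R) chi = chi q0.2 - chi q0.1.
Proof.
move=> uK q0K; rewrite /flow (bigD1_seq q0)//= eqxx mul1r big1 ?addr0// => q qq.
by rewrite (negbTE qq) mul0r.
Qed.

Lemma seq_argmin (I : eqType) (s : seq I) (r : I -> R) (x : I) : x \in s ->
  exists2 y, y \in s & forall z, z \in s -> r y <= r z.
Proof.
elim: s x => // a s IH x _; case: s IH => [|b s] IH.
  by exists a; rewrite ?mem_head// => z; rewrite inE => /eqP ->.
have [y ys ymin] := IH b (mem_head _ _).
have [ay|ya] := leP (r a) (r y).
  exists a; first exact: mem_head.
  by move=> z; rewrite inE => /predU1P[->//|/ymin]; exact: le_trans.
exists y; first by rewrite inE ys orbT.
by move=> z; rewrite inE => /predU1P[->|/ymin//]; exact: ltW.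
Qed.

Lemma count_lt (I : eqType) (s : seq I) (a1 a2 : pred I) (x : I) :
  x \in s -> a2 x -> ~~ a1 x -> (forall y, y \in s -> a1 y -> a2 y) ->
  (count a1 s < count a2 s)%N.
Proof.
move=> xs a2x a1x a12.
have H : (count (predU a1 (pred1 x)) s <= count a2 s)%N.
  rewrite (@eq_in_count _ _ (predI a2 (predU a1 (pred1 x)))) => [|y ys /=].
    by apply: sub_count => y /= /andP[].
  have [->|_] /= := eqVneq y x; first by rewrite a2x orbT.
  by rewrite orbF; case: (boolP (a1 y)) => [/(a12 _ ys) ->|]; rewrite ?andbF.
apply: leq_trans H; rewrite -[X in (X < _)%N]addn0.
have := count_predUI a1 (pred1 x) s.
rewrite (_ : count (predI a1 (pred1 x)) s = 0%N); last first.
  apply/eqP; rewrite -leqn0 leqNgt -has_count; apply/hasPn => y _ /=.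
  by apply/negP => /andP[a1y /eqP yx]; rewrite -yx a1y in a1x.
by rewrite addn0 => ->; rewrite ltn_add2l -has_count has_pred1.
Qed.

(* If an edge carries more than [M], its tail is reachable from its head along
   edges of positive weight: otherwise the set of reachable vertices would
   receive more than [M].  Hence there is a circulation to subtract. *)
Lemma bounded_weights K w M : uniq K -> (forall q, q \in K -> 0 <= w q) ->
  (forall chi, (forall v, 0 <= chi v <= 1) -> flow K w chi <= M) ->
  exists w', (forall q, q \in K -> [/\ 0 <= w' q, w' q <= w q & w' q <= M])
    /\ (forall chi, flow K w' chi = flow K w chi).
Proof.
move=> uK; have [N] := ubnP (count (fun q => 0 < w q) K).
elim: N w => // N IH w; rewrite ltnS => cN w0 HM.
have [/allP wM|/allPn[e0 e0K]] := boolP (all (fun q => w q <= M) K).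
  by exists w; split => // q qK; rewrite w0// wM.
rewrite -ltNge => Me0.
have M0 : 0 <= M.
  have := HM (fun=> 0); rewrite /flow big1; first by apply => v; rewrite lexx ler01.
  by move=> q _; rewrite subrr mulr0.
(* Reachability of [v] from the head of [e0] is witnessed by a unit flow on edges of positive weight
   rather than by a path: appending an edge adds its indicator, and repetitions are harmless. *)
pose supp g := (forall q, 0 <= g q) /\ forall q, 0 < g q -> q \in K /\ 0 < w q.
pose S v := exists g, supp g /\ forall chi, flow K g chi = chi v - chi e0.2.
have supp1 g q : supp g -> q \in K -> 0 < w q ->
    supp (fun q' => g q' + 1 * (q' == q)%:R).
  move=> [g0 gp] qK wq; split=> q'; first by rewrite mul1r addr_ge0.
  by case: (eqVneq q' q) => [->//|_]; rewrite mulr0 addr0; exact: gp.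
have Sb : S e0.2.
  exists (fun=> 0); split; first by split => // q; rewrite ltxx.
  by move=> chi; rewrite /flow big1 ?subrr// => q _; rewrite mul0r.
have Sstep q : q \in K -> 0 < w q -> S q.1 -> S q.2.
  move=> qK wq [g [sg fg]]; exists (fun q' => g q' + 1 * (q' == q)%:R).
  split; first exact: supp1.
  by move=> chi; rewrite flow_add fg flow_pred1//; ring.
have we0 : 0 < w e0 by exact: le_lt_trans Me0.
have [Sa|NSa] := pselect (S e0.1).
  have [g [sg fg]] := Sa.
  pose g' q' := g q' + 1 * (q' == e0)%:R.
  have [g'0 g'p] : supp g' by exact: supp1.
  have fg' chi : flow K g' chi = 0 by rewrite flow_add fg flow_pred1//; ring.
  have e0s : e0 \in [seq q <- K | 0 < g' q].
    rewrite mem_filter e0K andbT /g' eqxx mulr1 ltr_wpDl//; exact: sg.1.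
  (* Closing the flow with [e0] gives a circulation [g']. The smallest ratio [w q / g' q] is the
     largest multiple of [g'] that can be subtracted; it empties [q0], so the number of positive
     edges drops. *)
  have [q0] := seq_argmin (fun q => w q / g' q) e0s.
  rewrite mem_filter => /andP[gq0 q0K] q0min.
  set t := w q0 / g' q0 in q0min.
  have [_ wq0] := g'p _ gq0.
  have t0 : 0 < t by exact: divr_gt0.
  pose w1 q := w q + (- t) * g' q.
  have w1_le q : w1 q <= w q by rewrite /w1 mulNr gerDl oppr_le0 mulr_ge0// ltW.
  have w1_ge q : q \in K -> 0 <= w1 q.
    move=> qK; rewrite /w1 mulNr subr_ge0.
    have [gq|gq] := ltP 0 (g' q).
      by rewrite -ler_pdivlMr// q0min// mem_filter gq.
    have -> : g' q = 0 by apply/eqP; rewrite eq_le gq g'0.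
    by rewrite mulr0 w0.
  have f1 chi : flow K w1 chi = flow K w chi by rewrite flow_add fg' mulr0 addr0.
  have c1 : (count (fun q => (0 < w1 q)%R) K < N)%N.
    apply: leq_trans cN; apply: (@count_lt _ _ _ _ q0) => //.
      rewrite /w1 /t mulNr divfK ?subrr ?ltxx//; exact: lt0r_neq0.
    by move=> q _ /lt_le_trans; apply.
  have [|w2 [w2P w2f]] := IH w1 c1 w1_ge.
    by move=> chi /HM; rewrite f1.
  exists w2; split; last by move=> chi; rewrite w2f f1.
  by move=> q qK; have [? ? ?] := w2P _ qK; split => //; exact: le_trans (w1_le q).
(* For the indicator of the reachable set no positive edge has a negative term, as none leaves this
   set, while [e0] enters it with weight above [M]. *)
pose chi v : R := `[< S v >]%:R.
have chi01 v : 0 <= chi v <= 1 by rewrite /chi; case: asbool; rewrite ?lexx ?ler01.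
have := HM chi chi01; rewrite /flow (bigD1_seq e0)//=.
have -> : chi e0.2 = 1 by rewrite /chi asboolT.
have -> : chi e0.1 = 0 by rewrite /chi asboolF.
rewrite subr0 mulr1 => H; exfalso; move: H; apply/negP; rewrite -ltNge.
apply: (lt_le_trans Me0); rewrite lerDl big_seq_cond sumr_ge0// => q /andP[qK _].
have [wq|wq] := ltP 0 (w q); last first.
  by have -> : w q = 0 by [apply/eqP; rewrite eq_le wq w0]; rewrite mul0r.
apply: mulr_ge0; first exact: ltW.
rewrite subr_ge0 /chi ler_nat; case: (asboolP (S q.1)) => // /(Sstep _ qK wq) S2.
by rewrite asboolT.
Qed.

End Circulation.

(** * Truncation of a discrete flux *)

(** The sum integrates over [[a, a + L]] to at most [C]. Allowing twice the mean value makes failure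
    at every level absurd: it would give [2 * C <= C]. *)
Lemma exists_low_level (R : realType) (I : eqType) (r : seq I) (lo hi c : I -> R)
    (a L C : R) : 0 < L -> 0 < C ->
  (forall i, i \in r -> 0 <= c i /\ lo i <= hi i) ->
  \sum_(i <- r) c i * (hi i - lo i) <= C ->
  exists2 s, a <= s <= a + L & \sum_(i <- r | lo i <= s < hi i) c i <= 2 * C / L.
Proof.
move=> L0 C0 Hr HC; apply: contrapT => /forall2NP H.
pose D : set (measurableTypeR R) := `[a, a + L]%classic.
have mD : measurable D by exact: measurable_itv.
pose A i : set (measurableTypeR R) := `[lo i, hi i[%classic.
have mA i : measurable (A i) by exact: measurable_itv.
(* The absolute value makes [g i] nonnegative for every [i], also outside [r]. *)
pose g i (s : measurableTypeR R) : \bar R := (`|c i|%:E * (\1_(A i) s)%:E)%E.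
have g0 i s : (0 <= g i s)%E by rewrite /g -EFinM lee_fin mulr_ge0.
have mind i : measurable_fun D (fun s => (\1_(A i) s : R)%:E).
  by apply/measurable_EFinP; exact: measurable_indic.
have mg i : measurable_fun D (g i).
  by apply/measurable_EFinP; apply: measurable_funM => //; exact: measurable_indic.
have H1 : (\int[lebesgue_measure]_(s in D) (2 * C / L)%:E
    <= \int[lebesgue_measure]_(s in D) (\sum_(i <- r) g i s)%R)%E.
  apply: ge0_le_integral => //.
  - by move=> s _; rewrite lee_fin divr_ge0// ?mulr_ge0// ltW.
  - exact: emeasurable_sum.
  move=> s; rewrite /D /= in_itv /= => sD.
  case: (H s) => [//|/negP]; rewrite -ltNge => /ltW Hs.
  rewrite /g sumEFin lee_fin; apply: (le_trans Hs).
  rewrite big_mkcond big_seq [leRHS]big_seq; apply: ler_sum => i ir.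
  rewrite ger0_norm; last by case: (Hr _ ir).
  rewrite indicE; case: ifP => Hi; last by rewrite mulr_ge0//; case: (Hr _ ir).
  by rewrite mem_set ?mulr1// /A /= in_itv.
have H2 : (\int[lebesgue_measure]_(s in D) (\sum_(i <- r) g i s)%R <= C%:E)%E.
  rewrite ge0_integral_sum//.
  have E i : (\int[lebesgue_measure]_(s in D) g i s
      = `|c i|%:E * lebesgue_measure (A i `&` D))%E.
    by rewrite ge0_integralZl// ?integral_indic// => s _; rewrite lee_fin.
  under eq_bigr do rewrite E.
  apply: (@le_trans _ _ (\sum_(i <- r) (c i * (hi i - lo i))%:E)%E); last first.
    by rewrite sumEFin lee_fin.
  rewrite big_seq [leRHS]big_seq; apply: lee_sum => i ir.
  have [ci lh] := Hr _ ir; rewrite ger0_norm// EFinM lee_wpmul2l ?lee_fin//.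
  apply: (@le_trans _ _ (lebesgue_measure (A i))).
    by apply: le_measure; rewrite ?inE//; exact: measurableI.
  rewrite /A lebesgue_measure_itv /= lte_fin; case: ifP => _; first by rewrite EFinB.
  by rewrite lee_fin subr_ge0.
have H3 : (\int[lebesgue_measure]_(s in D) (2 * C / L)%:E = (2 * C)%:E)%E.
  have LD : lebesgue_measure (`[a, a + L]%classic : set R) = L%:E.
    by rewrite lebesgue_measure_itv /= lte_fin ltrDl L0 -EFinB addrC addKr.
  rewrite integral_cst//; transitivity ((2 * C / L)%:E * L%:E)%E.
    by congr (_ * _)%E; exact: LD.
  by rewrite -EFinM divfK// gt_eqF.
have := le_trans H1 H2; rewrite H3 lee_fin; lra.
Qed.

Section Truncation.
Variables (R : realType) (n : nat).
Local Notation V := 'rV[R]_n.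
Implicit Types (sp sm mm : dmass R n) (E : seq ((V * V) * R)) (s : R).

Lemma norm_le_enorm (x : V) : `|x| <= enorm x.
Proof.
apply: le_mx_norm => [|i]; first exact: sqrtr_ge0.
rewrite -sqrtr_sqr; apply: ler_wsqrtr; rewrite /dotp (bigD1 i)//= -expr2 lerDl.
by rewrite sumr_ge0// => j _; rewrite -expr2 sqr_ge0.
Qed.

Definition trunc_mass s mm : dmass R n := [seq p <- mm | `|p.2| <= s].

(** Weight 0 is filtered out because atoms of a discrete mass must be positive. *)
Definition cross_in s E : dmass R n :=
  [seq (e.2, e.1.2) | e <- [seq e <- E | (`|e.1.2| <= s < `|e.1.1|) && (0 < e.2)]].

Definition cross_out s E : dmass R n :=
  [seq (e.2, e.1.1) | e <- [seq e <- E | (`|e.1.1| <= s < `|e.1.2|) && (0 < e.2)]].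

Definition trunc_edges s E : seq ((V * V) * R) :=
  [seq e <- E | (`|e.1.1| <= s) && (`|e.1.2| <= s)].

Lemma dmass_int_trunc s mm chi :
  dmass_int (trunc_mass s mm) chi = dmass_int mm (fun x => chi x * (`|x| <= s)%R%:R).
Proof.
rewrite /dmass_int big_filter big_mkcond; apply: eq_bigr => p _.
by case: ifP; rewrite ?mulr1 ?mulr0.
Qed.

Lemma dmass_int_cat (m1 m2 : dmass R n) chi :
  dmass_int (m1 ++ m2) chi = dmass_int m1 chi + dmass_int m2 chi.
Proof. exact: big_cat. Qed.

Lemma balanced_trunc s sp sm E : balanced sp sm E ->
  (forall e, e \in E -> 0 <= e.2) ->
  balanced (trunc_mass s sp ++ cross_in s E) (trunc_mass s sm ++ cross_out s E)
    (trunc_edges s E).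
Proof.
move=> B w0 chi; have := B (fun x => chi x * (`|x| <= s)%R%:R).
rewrite !dmass_int_cat !dmass_int_trunc -!addrA.
have -> : \sum_(e <- E) e.2 * (chi e.1.2 * (`|e.1.2| <= s)%R%:R)
    = dmass_int (cross_in s E) chi + \sum_(e <- trunc_edges s E) e.2 * chi e.1.2.
  rewrite /dmass_int /cross_in /trunc_edges big_map !big_filter /=.
  rewrite [X in _ = X + _]big_mkcond [X in _ = _ + X]big_mkcond -big_split /=.
  apply: eq_big_seq => e /w0; rewrite le_eqVlt => /predU1P[<-|e0].
    by rewrite !mul0r; do 2 case: ifP => _; rewrite addr0.
  rewrite e0 andbT; case: (leP `|e.1.2| s); case: (leP `|e.1.1| s) => _ _ /=;
    by rewrite ?mulr1 ?mulr0 ?addr0 ?add0r.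
have -> // : \sum_(e <- E) e.2 * (chi e.1.1 * (`|e.1.1| <= s)%R%:R)
    = dmass_int (cross_out s E) chi + \sum_(e <- trunc_edges s E) e.2 * chi e.1.1.
rewrite /dmass_int /cross_out /trunc_edges big_map !big_filter /=.
rewrite [X in _ = X + _]big_mkcond [X in _ = _ + X]big_mkcond -big_split /=.
apply: eq_big_seq => e /w0; rewrite le_eqVlt => /predU1P[<-|e0].
  by rewrite !mul0r; do 2 case: ifP => _; rewrite addr0.
rewrite e0 andbT; case: (leP `|e.1.2| s); case: (leP `|e.1.1| s) => _ _ /=;
  by rewrite ?mulr1 ?mulr0 ?addr0 ?add0r.
Qed.

Lemma weight_function E : uniq (map fst E) ->
  exists w : V * V -> R, forall e, e \in E -> e.2 = w e.1.
Proof.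
elim: E => [|e E IH] /=; first by exists (fun=> 0).
move=> /andP[eE /IH[w Hw]].
exists (fun q => if q == e.1 then e.2 else w q) => e'; rewrite inE.
case/predU1P => [->|e'E]; first by rewrite eqxx.
case: eqP => [qe|_]; last exact: Hw.
by rewrite -qe map_f in eE.
Qed.

(** For [0 <= chi <= 1] the balance turns the flow into [dmass_int sm chi - dmass_int sp chi], which
    is at most the total mass of [sm]. *)
Lemma bounded_edges sp sm E : dmass_ok sp -> dmass_ok sm -> balanced sp sm E ->
  uniq (map fst E) -> (forall e, e \in E -> 0 <= e.2) ->
  exists w : V * V -> R,
    (forall e, e \in E -> [/\ 0 <= w e.1, w e.1 <= e.2 & w e.1 <= dmass_total sm])
    /\ balanced sp sm [seq (e.1, w e.1) | e <- E].
Proof.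
move=> /allP ok1 /allP ok2 B uE w0; have [w1 Hw1] := weight_function uE.
have flowE (w : V * V -> R) chi : flow (map fst E) w chi
    = \sum_(e <- E) w e.1 * chi e.1.2 - \sum_(e <- E) w e.1 * chi e.1.1.
  by rewrite /flow big_map -sumrB; apply: eq_bigr => e _; rewrite mulrBr.
have flow1 chi : flow (map fst E) w1 chi = dmass_int sm chi - dmass_int sp chi.
  have := B chi; rewrite flowE.
  have H (u : (V * V) * R -> R) : \sum_(e <- E) w1 e.1 * u e = \sum_(e <- E) e.2 * u e.
    by apply: eq_big_seq => e /Hw1 ->.
  rewrite (H (fun e => chi e.1.2)) (H (fun e => chi e.1.1)); lra.
have [||w [Hw fw]] := @bounded_weights _ _ (map fst E) w1 (dmass_total sm) uE.
- by move=> q /mapP[e eE ->]; rewrite -Hw1// w0.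
- move=> chi chi01; rewrite flow1.
  have : 0 <= dmass_int sp chi.
    rewrite /dmass_int big_seq sumr_ge0// => p /ok1/ltW p0; rewrite mulr_ge0//.
    by case/andP: (chi01 p.2).
  have : dmass_int sm chi <= dmass_total sm.
    rewrite /dmass_int /dmass_total big_seq [leRHS]big_seq; apply: ler_sum => p /ok2/ltW p0.
    by rewrite ler_piMr//; case/andP: (chi01 p.2).
  lra.
exists w; split.
  by move=> e eE; have [] := Hw e.1 (map_f _ eE); rewrite -Hw1.
move=> chi; have := fw chi; rewrite flow1 flowE !big_map /=; lra.
Qed.

(** Some level is crossed by edges of total [tau]-value at most [2 * C / L < tau 1]. By monotonicity
    each of them has weight at most 1, where a weight is at most [2 / tau 1] times its [tau]-value;
    the product of the two factors bounds the cut mass. Deleting edges and lowering weights never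
    raises the cost. *)
Lemma truncated_flux (tau : R -> R) sp sm (G : graph R n) (C a L : R) :
  transportation_cost tau -> dmass_ok sp -> dmass_ok sm -> is_dflux sp sm G ->
  gcost tau G <= C -> 0 < C -> 0 < L -> 2 * C / L < tau 1 ->
  exists s ci co G', [/\ a <= s <= a + L, dmass_ok ci /\ dmass_ok co,
    dmass_total ci <= 4 * C / (L * tau 1) /\ dmass_total co <= 4 * C / (L * tau 1),
    is_dflux (trunc_mass s sp ++ ci) (trunc_mass s sm ++ co) G' &
    gcost tau G' <= gcost tau G /\
    forall q, q \in gedges G' ->
      0 <= q.2 <= dmass_total (trunc_mass s sm ++ co)].
Proof.
move=> tc ok1 ok2 GF GC C0 L0 CL; have [_ tp tn _ _] := tc.
have [_ uE HE _] := GF; have B := dflux_balanced GF.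
set E := gedges G in uE HE B.
have w0 e : e \in E -> 0 <= e.2 by case/HE.
have t10 : 0 < tau 1 by exact: tp.
pose lo (e : (V * V) * R) := Num.min `|e.1.1| `|e.1.2|.
pose hi (e : (V * V) * R) := Num.max `|e.1.1| `|e.1.2|.
have [||s sa Hs] := @exists_low_level R _ E lo hi (fun e => tau e.2) a L C L0 C0.
- move=> e eE; split; first by apply: (tc_ge0 tc); exact: w0.
  by rewrite /lo /hi ge_min le_max lexx.
- apply: le_trans GC; rewrite /gcost -/E big_seq [leRHS]big_seq; apply: ler_sum => e eE.
  rewrite ler_wpM2l ?(tc_ge0 tc) ?w0//.
  apply: le_trans (norm_le_enorm _).
  apply: (@le_trans _ _ `| `|e.1.2| - `|e.1.1| |); last exact: ler_dist_dist.
  by rewrite /hi /lo; case: (leP `|e.1.1| `|e.1.2|) => _; rewrite ?ler_norm// distrC ler_norm.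
have cross e : e \in E -> lo e <= s < hi e -> e.2 <= 2 / tau 1 * tau e.2.
  move=> eE Hc; have t1 : tau e.2 < tau 1.
    apply: le_lt_trans CL; apply: le_trans Hs; rewrite (big_rem e)//= Hc lerDl.
    rewrite big_seq_cond sumr_ge0// => e' /andP[/mem_rem e'E _].
    by apply: (tc_ge0 tc); exact: w0.
  have e1 : e.2 <= 1.
    by rewrite leNgt; apply/negP => /ltW H; have := tn _ _ ler01 H; rewrite leNgt t1.
  have := @tc_linear_bound _ _ tc e.2 1; rewrite w0// e1 => /(_ isT ltr01).
  by rewrite mulr1 mulrAC ler_pdivlMr.
have crossT (P : pred ((V * V) * R)) (f : (V * V) * R -> R * V) :
    (forall e, P e -> lo e <= s < hi e) -> (forall e, (f e).1 = e.2) ->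
    dmass_total [seq f e | e <- [seq e <- E | P e && (0 < e.2)]] <= 4 * C / (L * tau 1).
  move=> PH f1; rewrite /dmass_total big_map big_filter.
  apply: (@le_trans _ _ (2 / tau 1 * \sum_(e <- E | lo e <= s < hi e) tau e.2)); last first.
    have -> : 4 * C / (L * tau 1) = 2 / tau 1 * (2 * C / L).
      by field; rewrite !gt_eqF.
    by rewrite ler_pM2l// divr_gt0.
  rewrite mulr_sumr big_mkcond [leRHS]big_mkcond big_seq [leRHS]big_seq.
  apply: ler_sum => e eE; rewrite f1; case: ifP => [/andP[/PH He _]|_].
    by rewrite He; exact: cross.
  by case: ifP => // _; rewrite mulr_ge0 ?divr_ge0 ?(ltW t10) ?(tc_ge0 tc) ?w0.
have okc (P : pred ((V * V) * R)) (f : (V * V) * R -> R * V) :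
    (forall e, (f e).1 = e.2) ->
    dmass_ok [seq f e | e <- [seq e <- E | P e && (0 < e.2)]].
  move=> f1; apply/allP => _ /mapP[e + ->].
  by rewrite mem_filter f1 => /andP[/andP[]].
have okt mm : dmass_ok mm -> dmass_ok (trunc_mass s mm).
  by move=> /allP H; apply/allP => p; rewrite mem_filter => /andP[_ /H].
have okcat (m1 m2 : dmass R n) : dmass_ok m1 -> dmass_ok m2 -> dmass_ok (m1 ++ m2).
  by move=> H1 H2; rewrite /dmass_ok all_cat; apply/andP.
have ok_in : dmass_ok (cross_in s E) by exact: okc.
have ok_out : dmass_ok (cross_out s E) by exact: okc.
have uT : uniq (map fst (trunc_edges s E)).
  by apply: subseq_uniq uE; apply: map_subseq; exact: filter_subseq.
have sT e : e \in trunc_edges s E -> e \in E by rewrite mem_filter => /andP[].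
have [w [Hw Bw]] := bounded_edges (okcat _ _ (okt _ ok1) ok_in)
  (okcat _ _ (okt _ ok2) ok_out) (balanced_trunc s B w0) uT (fun e H => w0 e (sT e H)).
exists s, (cross_in s E), (cross_out s E),
  (Graph (gvert G) [seq (e.1, w e.1) | e <- trunc_edges s E]); split => //.
- split; apply: crossT => // e /andP[H1 H2]; rewrite /lo /hi ge_min lt_max H1 H2 ?orbT//.
- apply: balanced_dflux => //=; first by rewrite -map_comp (eq_map (g := fst)).
  move=> q /mapP[e eT ->] /=; have [? _ ? ?] := HE _ (sT _ eT); split => //.
  by have [] := Hw _ eT.
split => /=.
  rewrite /gcost /= big_map big_filter -/E big_mkcond /= big_seq [leRHS]big_seq.
  apply: ler_sum => e eE; case: ifP => [eT|_]; last first.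
    by rewrite mulr_ge0 ?(tc_ge0 tc) ?w0// sqrtr_ge0.
  have eT' : e \in trunc_edges s E by rewrite mem_filter eT.
  have [Hw0 Hw1 _] := Hw _ eT'.
  by rewrite ler_wpM2r ?sqrtr_ge0//; exact: tn.
by move=> q /mapP[e eT ->] /=; have [-> _ ->] := Hw _ eT.
Qed.

End Truncation.

(** * Partitions of unity *)

Section PartitionOfUnity.
Variables (R : realType) (V : normedModType R).
Implicit Types (x y c : V) (r d : R).

Lemma lipschitz1_continuous (f : V -> R) :
  (forall x y, `|f x - f y| <= `|x - y|) -> continuous f.
Proof.
move=> H x; apply/cvgrPdist_lt => e e0.
have /cvgrPdist_lt/(_ _ e0) : id y @[y --> x] --> x by exact: cvg_id.
by apply: filterS => y /=; exact: le_lt_trans (H _ _).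
Qed.

Lemma maxr0_lipschitz (r s : R) : `|Num.max 0 r - Num.max 0 s| <= `|r - s|.
Proof.
have h1 := ler_norm (r - s); have h2 := ler_norm (s - r); rewrite distrC in h2.
by case: (leP 0 r) => ?; case: (leP 0 s) => ?; rewrite ler_norml; lra.
Qed.

Lemma minr1_lipschitz (r s : R) : `|Num.min 1 r - Num.min 1 s| <= `|r - s|.
Proof.
have h1 := ler_norm (r - s); have h2 := ler_norm (s - r); rewrite distrC in h2.
by case: (leP 1 r) => ?; case: (leP 1 s) => ?; rewrite ler_norml; lra.
Qed.

Definition cutoff r x : R := Num.max 0 (Num.min 1 (r + 1 - `|x|)).

Definition bump d c x : R := Num.max 0 (d - `|x - c|).

(** Keeps the denominator [bump_sum] positive beyond radius [r + 1], where all bumps may vanish, and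
    is 0 within that radius, so the quotients still sum to [cutoff r]. *)
Definition outer r x : R := Num.max 0 (`|x| - (r + 1)).

Definition bump_sum (cs : seq V) r d x : R := \sum_(c <- cs) bump d c x + outer r x.

Definition unity (cs : seq V) r d c x : R := cutoff r x * (bump d c x / bump_sum cs r d x).

Lemma cutoff_continuous r : continuous (cutoff r).
Proof.
apply: lipschitz1_continuous => x y; apply: (le_trans (maxr0_lipschitz _ _)).
apply: (le_trans (minr1_lipschitz _ _)).
by rewrite opprB addrC addrA subrK distrC; exact: ler_dist_dist.
Qed.

Lemma bump_continuous d c : continuous (bump d c).
Proof.
apply: lipschitz1_continuous => x y; apply: (le_trans (maxr0_lipschitz _ _)).
rewrite opprB addrC addrA subrK distrC; apply: (le_trans (ler_dist_dist _ _)).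
by rewrite opprB addrA subrK.
Qed.

Lemma outer_continuous r : continuous (outer r).
Proof.
apply: lipschitz1_continuous => x y; apply: (le_trans (maxr0_lipschitz _ _)).
by rewrite opprB addrA subrK; exact: ler_dist_dist.
Qed.

Lemma bump_sum_continuous cs r d : continuous (bump_sum cs r d).
Proof.
move=> x; have H : \sum_(c <- cs) bump d c y @[y --> x] --> \sum_(c <- cs) bump d c x.
  elim: cs => [|c cs IH].
    by rewrite big_nil; under eq_fun do rewrite big_nil; exact: cvg_cst.
  rewrite big_cons; under eq_fun do rewrite big_cons.
  exact: (cvgD (@bump_continuous d c x) IH).
exact: (cvgD H (@outer_continuous r x)).
Qed.

Lemma unity_continuous cs r d c : (forall x, 0 < bump_sum cs r d x) ->
  continuous (unity cs r d c).
Proof.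
move=> H x; have nz : bump_sum cs r d x != 0 by rewrite gt_eqF.
have H1 : (bump_sum cs r d y)^-1 @[y --> x] --> (bump_sum cs r d x)^-1.
  by apply: (cvgV nz); exact: bump_sum_continuous.
have H2 : bump d c y / bump_sum cs r d y @[y --> x] --> bump d c x / bump_sum cs r d x.
  exact: (cvgM (@bump_continuous d c x) H1).
exact: (cvgM (@cutoff_continuous r x) H2).
Qed.

Lemma cutoff_ge0 r x : 0 <= cutoff r x.
Proof. by rewrite /cutoff le_max lexx. Qed.

Lemma cutoff_le1 r x : cutoff r x <= 1.
Proof. by rewrite /cutoff ge_max ler01 ge_min lexx. Qed.

Lemma cutoff_in r x : `|x| <= r -> cutoff r x = 1.
Proof.
move=> H; rewrite /cutoff min_l; last by lra.
by rewrite max_r.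
Qed.

Lemma cutoff_out r x : r + 1 <= `|x| -> cutoff r x = 0.
Proof. by move=> H; rewrite /cutoff max_l// ge_min; apply/orP; right; lra. Qed.

Lemma bump_ge0 d c x : 0 <= bump d c x.
Proof. by rewrite /bump le_max lexx. Qed.

Lemma bump_sum_gt0 cs r d :
  (forall x, `|x| <= r + 1 -> exists2 c, c \in cs & `|x - c| < d) ->
  forall x, 0 < bump_sum cs r d x.
Proof.
move=> H x; rewrite /bump_sum; have [xr|xr] := leP `|x| (r + 1).
  have [c cc xc] := H _ xr; rewrite ltr_pwDl ?le_max ?lexx// (big_rem c)//=.
  by rewrite ltr_pwDl ?sumr_ge0// => [|c' _]; rewrite ?bump_ge0// /bump lt_max subr_gt0 xc orbT.
rewrite ltr_wpDl ?sumr_ge0// => [c _|]; first exact: bump_ge0.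
by rewrite /outer lt_max subr_gt0 xr orbT.
Qed.

Lemma unity_ge0 cs r d c x : 0 < bump_sum cs r d x -> 0 <= unity cs r d c x.
Proof. by move=> H; rewrite mulr_ge0 ?cutoff_ge0// divr_ge0 ?bump_ge0// ltW. Qed.

Lemma unity_sum cs r d x : 0 < bump_sum cs r d x ->
  \sum_(c <- cs) unity cs r d c x = cutoff r x.
Proof.
move=> H; rewrite -mulr_sumr -mulr_suml; have [xr|xr] := leP `|x| (r + 1).
  have E : outer r x = 0 by rewrite /outer max_l// subr_le0.
  by move: H; rewrite /bump_sum E addr0 => H; rewrite divff ?mulr1// gt_eqF.
by rewrite cutoff_out ?mul0r// ltW.
Qed.

Lemma unity_far cs r d c x : d <= `|x - c| -> unity cs r d c x = 0.
Proof.
move=> H; rewrite /unity (_ : bump d c x = 0) ?mul0r ?mulr0//.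
by rewrite /bump max_l// subr_le0.
Qed.

Lemma unity_out cs r d c x : r + 1 <= `|x| -> unity cs r d c x = 0.
Proof. by move=> H; rewrite /unity cutoff_out// mul0r. Qed.

Lemma unity_approx cs r d (f : V -> R) (e : R) x : 0 < bump_sum cs r d x ->
  (forall x y, `|x - y| < d -> `|f x - f y| <= e) ->
  `|f x * cutoff r x - \sum_(c <- cs) f c * unity cs r d c x| <= e * cutoff r x.
Proof.
move=> H Hf; rewrite -(unity_sum H) !mulr_sumr -sumrB.
apply: (le_trans (ler_norm_sum _ _ _)); apply: ler_sum => c _.
rewrite -mulrBl normrM [X in _ * X]ger0_norm ?unity_ge0//.
have [xc|xc] := ltP `|x - c| d; first by rewrite ler_wpM2r ?unity_ge0// Hf.
by rewrite unity_far// !mulr0.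
Qed.

End PartitionOfUnity.

(** * Finite nets and integrals against measures of bounded support *)

Section BallNet.
Variables (R : realType) (n : nat).
Local Notation V := 'rV[R]_n.

Lemma ball_net (r d : R) : 0 < d ->
  exists cs : seq V, forall x : V, `|x| <= r -> exists2 c, c \in cs & `|x - c| < d.
Proof.
move=> d0; have := @closed_ball_compact R n r.
rewrite compact_cover => /(_ V setT (fun c => ball c d)) [|x _|cs _ Hcs].
- by move=> c _; exact: ball_open.
- by exists x => //; exact: ballxx.
exists (finmap.enum_fset cs) => x xr; have [c cc] := Hcs x xr.
by rewrite -ball_normE /= => xc; exists c => //; rewrite distrC.
Qed.

Lemma cutoff_C0 (r : R) : C0 (cutoff r : V -> R).
Proof.
split; first exact: cutoff_continuous.
by move=> e e0; exists (r + 1) => x xr; rewrite cutoff_out ?normr0// ltW.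
Qed.

Lemma unity_C0 (cs : seq V) r d c : (forall x, 0 < bump_sum cs r d x) ->
  C0 (unity cs r d c : V -> R).
Proof.
move=> H; split; first exact: unity_continuous.
by move=> e e0; exists (r + 1) => x xr; rewrite unity_out ?normr0// ltW.
Qed.

Lemma C0_lincomb (I : Type) (cs : seq I) (a : I -> R) (g : I -> V -> R) :
  (forall c, C0 (g c)) -> C0 (fun x => \sum_(c <- cs) a c * g c x).
Proof.
move=> Cg; elim: cs => [|c cs [IH1 IH2]].
  split; first by under eq_fun do rewrite big_nil; exact: cst_continuous.
  by move=> e e0; exists 0 => x _; rewrite big_nil normr0.
have [cg vg] := Cg c; split.
  move=> x; rewrite /continuous_at big_cons; under eq_fun do rewrite big_cons.
  exact: (cvgD (cvgMl_tmp (a := a c) (cg x)) (IH1 x)).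
move=> e e0; have e20 : 0 < e / 2 by rewrite divr_gt0.
have e30 : 0 < e / 2 / (`|a c| + 1) by rewrite divr_gt0// ltr_wpDl.
have [r1 H1] := vg _ e30; have [r2 H2] := IH2 _ e20.
exists (Num.max r1 r2) => x; rewrite gt_max => /andP[/H1 x1 /H2 x2].
rewrite big_cons (le_lt_trans (ler_normD _ _))// [ltRHS]splitr ltrD// normrM.
apply: (@le_lt_trans _ _ ((`|a c| + 1) * `|g c x|)); first by rewrite ler_wpM2r// lerDl.
by move: x1; rewrite ltr_pdivlMr ?ltr_wpDl// mulrC.
Qed.

Lemma mint_lincomb (mu : fmeasure R n) (I : Type) (cs : seq I) (a : I -> R) (g : I -> V -> R) :
  (forall c, C0 (g c)) ->
  mint mu (fun x => \sum_(c <- cs) a c * g c x) = \sum_(c <- cs) a c * mint mu (g c).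
Proof.
move=> Cg; elim: cs => [|c cs IH].
  rewrite big_nil /mint; under eq_integral do rewrite big_nil.
  by rewrite integral0.
rewrite big_cons -IH /mint; under eq_integral do rewrite big_cons.
have i1 := @C0_integrable _ _ mu _ (Cg c).
have i2 := @C0_integrable _ _ mu _ (C0_lincomb cs a Cg).
rewrite -[X in X + _](RintegralZl (a c) measurableT i1).
have i3 : mu.-integrable setT (EFin \o (fun x => a c * g c x)).
  rewrite (_ : _ \o _ = (fun x => (a c)%:E * (g c x)%:E)%E)//.
  exact: integrableZl.
exact: (RintegralD measurableT i3 i2).
Qed.

Lemma measurable_norm_gt (r : R) : measurable [set x : borelRn R n | r < `|x : V|].
Proof.
apply: sub_sigma_algebra.
rewrite (_ : [set x | _] = (fun x : V => `|x|) @^-1` [set` `]r, +oo[]); last first.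
  by apply/seteqP; split => x /=; rewrite in_itv /= andbT.
apply: open_comp => [x _|]; first exact: norm_continuous.
exact: interval_open.
Qed.

Lemma mint_close (mu : fmeasure R n) (r e : R) (f1 f2 : V -> R) :
  mu [set x : borelRn R n | r < `|x : V|] = 0%E -> 0 <= e -> C0 f1 -> C0 f2 ->
  (forall x, `|x| <= r -> `|f1 x - f2 x| <= e) ->
  `|mint mu f1 - mint mu f2| <= e * fine (mu setT).
Proof.
move=> mu0 e0 C1 C2 H; pose N := [set x : borelRn R n | r < `|x : V|].
have mN : measurable N by exact: measurable_norm_gt.
have i1 := @C0_integrable _ _ mu _ C1; have i2 := @C0_integrable _ _ mu _ C2.
have -> : mint mu f1 - mint mu f2 = fine (\int[mu]_(x in setT `\` N) ((f1 x - f2 x)%:E))%E.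
  rewrite -[LHS](RintegralB measurableT i1 i2); congr fine.
  by apply: negligible_integral => //; exact: (integrableB measurableT i1 i2).
have fin : (mu (setT `\` N) <= mu setT)%E.
  by apply: le_measure; rewrite ?inE//; exact: measurableD.
have := @integral_label_approx _ _ _ mu (setT `\` N) unit (fun=> tt) (fun x => f1 x - f2 x)
  (fun=> 0) e.
rewrite big1 => [|? _]; last by rewrite mul0r.
rewrite subr0 => K; apply: (le_trans (K _ _ _ _ _)).
- exact: measurableD.
- by apply: (le_lt_trans fin); rewrite ltey_eq fin_num_measure.
- move=> i; apply: measurableI; first exact: measurableD.
  by rewrite (_ : [set _ | _] = setT)//; apply/seteqP; split => //; case: i.
- apply: (measurable_funS (E := setT)) => //; apply: measurable_funB.
    by apply: continuous_borel_measurable; case: C1.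
  by apply: continuous_borel_measurable; case: C2.
- by move=> x [_ /negP]; rewrite -leNgt subr0 => /H.
apply: ler_wpM2l => //; apply: fine_le => //; last exact: fin_num_measure.
by apply: fin_num_measure; exact: measurableD.
Qed.

End BallNet.

(** * Lower limits *)

Section Liminf.
Variables (R : realType) (u : nat -> R).

Lemma limn_einf_supE :
  limn_einf (fun k => (u k)%:E) = ereal_sup (range (einfs (fun k => (u k)%:E))).
Proof.
rewrite limn_einf_lim; apply: cvg_lim => //.
exact: ereal_nondecreasing_cvgn (nondecreasing_einfs _).
Qed.

Lemma limn_einf_lt_frequently (y : \bar R) : (limn_einf (fun k => (u k)%:E) < y)%E ->
  forall K, exists2 k, (K <= k)%N & ((u k)%:E < y)%E.
Proof.
rewrite limn_einf_supE => H K.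
have /le_lt_trans/(_ H) : (einfs (fun k => (u k)%:E) K
    <= ereal_sup (range (einfs (fun k => (u k)%:E))))%E.
  by apply: ereal_sup_ubound; exists K.
by move=> /ereal_inf_lt[_ [k /= Kk <-] ky]; exists k.
Qed.

Lemma limn_einf_le (l : R) :
  (forall e, 0 < e -> exists N, forall k, (N <= k)%N -> u k <= l + e) ->
  (limn_einf (fun k => (u k)%:E) <= l%:E)%E.
Proof.
move=> H; rewrite limn_einf_supE; apply: ge_ereal_sup => _ [K _ <-].
apply/lee_addgt0Pr => e /H[N HN].
apply: (@le_trans _ _ (u (maxn N K))%:E).
  by apply: ereal_inf_lbound; exists (maxn N K) => //=; exact: leq_maxr.
by rewrite -EFinD lee_fin HN// leq_maxl.
Qed.

Lemma limn_einf_ge0 : (forall k, 0 <= u k) -> (0 <= limn_einf (fun k => (u k)%:E))%E.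
Proof.
move=> u0; rewrite limn_einf_supE.
apply: (@le_trans _ _ (einfs (fun k => (u k)%:E) 0%N)).
  by apply: le_ereal_inf_tmp => _ [k _ <-]; rewrite lee_fin.
by apply: ereal_sup_ubound; exists 0%N.
Qed.

End Liminf.

(** * Quantitative weak convergence of truncated masses *)

Section Closeness.
Variables (R : realType) (n : nat).
Local Notation V := 'rV[R]_n.
Implicit Types (s T : dmass R n) (mu : fmeasure R n).

(** Uniform over test functions through their bound [B] and their oscillation [e] at scale
    [1 / (j + 1)]. For a fixed test function the error tends to 0 with [j], which gives weak
    convergence without metrizing it. *)
Definition weakly_close (j : nat) T mu : Prop := forall (f : V -> R) (B e : R),
  C0 f -> (forall x, `|f x| <= B) ->
  (forall x y, `|x - y| < j.+1%:R^-1 -> `|f x - f y| <= e) ->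
  `|dmass_int T f - mint mu f| <= 4 * B / j.+1%:R + e * (2 * fine (mu setT) + 1).

Lemma dmass_int_le s (f g : V -> R) : dmass_ok s ->
  (forall x, f x <= g x) -> dmass_int s f <= dmass_int s g.
Proof.
move=> /allP ok H; rewrite /dmass_int big_seq [leRHS]big_seq; apply: ler_sum => p /ok/ltW p0.
by rewrite ler_wpM2l.
Qed.

Lemma dmass_int_dist s (f g h : V -> R) : dmass_ok s ->
  (forall x, `|f x - g x| <= h x) -> `|dmass_int s f - dmass_int s g| <= dmass_int s h.
Proof.
move=> /allP ok H; rewrite /dmass_int -sumrB; apply: (le_trans (ler_norm_sum _ _ _)).
rewrite big_seq [leRHS]big_seq; apply: ler_sum => p /ok p0.
by rewrite -mulrBr normrM gtr0_norm// ler_pM2l.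
Qed.

Lemma dmass_intZ s (a : R) (f : V -> R) :
  dmass_int s (fun x => a * f x) = a * dmass_int s f.
Proof. by rewrite /dmass_int mulr_sumr; apply: eq_bigr => p _; rewrite mulrCA. Qed.

Lemma dmass_intB s (f g : V -> R) :
  dmass_int s (fun x => f x - g x) = dmass_int s f - dmass_int s g.
Proof. by rewrite /dmass_int -sumrB; apply: eq_bigr => p _; rewrite mulrBr. Qed.

Lemma dmass_int1 s : dmass_int s (fun=> 1) = dmass_total s.
Proof. by apply: eq_bigr => p _; rewrite mulr1. Qed.

Lemma mint_cutoff_le mu (r r' : R) :
  mu [set x : borelRn R n | r < `|x : V|] = 0%E -> mint mu (cutoff r') <= fine (mu setT).
Proof.
move=> mu0; have C00 : C0 (fun _ : V => 0 : R).
  split; first exact: cst_continuous.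
  by move=> e e0; exists 0 => x _; rewrite normr0.
have := @mint_close _ _ mu r 1 (cutoff r') (fun=> 0) mu0 ler01 (cutoff_C0 _ r') C00.
rewrite mul1r {2}/mint integral0 subr0 => H; apply: le_trans (ler_norm _) (H _).
by move=> x _; rewrite subr0 ger0_norm ?cutoff_ge0 ?cutoff_le1.
Qed.

(** The indicator of [|x| <= lev] lies between [cutoff r] and [cutoff (r + 1 + L)], which have the
    same [mu]-integral; hence [s] has mass at most [2 * d] between them. Any other test function is
    reduced to the finitely many functions of a partition of unity. *)
Lemma truncated_mass_close mu s (ci : dmass R n) (cs : seq V) (j : nat) (r L lev : R) :
  mu [set x : borelRn R n | r < `|x : V|] = 0%E -> 0 < L -> dmass_ok s -> dmass_ok ci ->
  (forall x : V, `|x| <= r + 1 -> exists2 c, c \in cs & `|x - c| < j.+1%:R^-1) ->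
  dmass_total ci <= j.+1%:R^-1 -> r + 1 <= lev <= r + 1 + L ->
  (forall c, c \in cs ->
    `|dmass_int s (unity cs r j.+1%:R^-1 c) - mint mu (unity cs r j.+1%:R^-1 c)|
      <= (j.+1 * (size cs).+1)%:R^-1) ->
  `|dmass_int s (cutoff r) - mint mu (cutoff r)| <= j.+1%:R^-1 ->
  `|dmass_int s (cutoff (r + 1 + L)) - mint mu (cutoff (r + 1 + L))| <= j.+1%:R^-1 ->
  weakly_close j (trunc_mass lev s ++ ci) mu /\
  dmass_total (trunc_mass lev s ++ ci) <= fine (mu setT) + 2.
Proof.
move=> mu0 L0 oks okci net tci /andP[lev1 lev2] H1 H2 H3.
set d : R := j.+1%:R^-1 in net tci H1 H2 H3 *.
have d0 : 0 < d by rewrite invr_gt0.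
have d1 : d <= 1 by rewrite invf_le1// ler1n.
have den0 := bump_sum_gt0 net.
have Cu c : C0 (unity cs r d c) by exact: unity_C0.
pose M := fine (mu setT).
have M0 : 0 <= M by rewrite fine_ge0.
have Mcut : mint mu (cutoff r) <= M by exact: mint_cutoff_le mu0.
have cutE : mint mu (cutoff (r + 1 + L)) = mint mu (cutoff r).
  apply/eqP; rewrite -subr_eq0 -normr_le0.
  apply: le_trans (mint_close mu0 (lexx 0) (cutoff_C0 _ _) (cutoff_C0 _ _) _) _; last by rewrite mul0r.
  move=> x xr; rewrite !cutoff_in ?subrr ?normr0//; apply: (le_trans xr); lra.
rewrite cutE in H3.
have cutS : dmass_int s (cutoff r) <= M + d by move: H2; rewrite ler_norml; lra.
have chiS : dmass_int s (cutoff (r + 1 + L)) <= M + d by move: H3; rewrite ler_norml; lra.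
have chicut : dmass_int s (cutoff (r + 1 + L)) - dmass_int s (cutoff r) <= 2 * d.
  by move: H2 H3; rewrite !ler_norml; lra.
split; last first.
  rewrite -dmass_int1 dmass_int_cat dmass_int_trunc dmass_int1.
  have : dmass_int s (fun x => 1 * (`|x| <= lev)%R%:R) <= dmass_int s (cutoff (r + 1 + L)).
    apply: dmass_int_le => // x; rewrite mul1r; case: (leP `|x| lev) => xl; last exact: cutoff_ge0.
    by rewrite cutoff_in// (le_trans xl).
  rewrite -/M; lra.
move=> f B e Cf fB fe; rewrite -/d -/M.
have e0 : 0 <= e by have := fe 0 0; rewrite !subrr !normr0; apply.
have B0 : 0 <= B by apply: le_trans (fB 0).
(* Error budget: [a1] and [a2] replace [f] by its values on the net, at most [e * (2 * M + 1)]
   together; testing ([a3]), truncation ([a4]) and cut edges ([a5]) cost [B * d], [2 * B * d] and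
   [B * d]. *)
pose S := \sum_(c <- cs) f c * dmass_int s (unity cs r d c).
pose Smu := \sum_(c <- cs) f c * mint mu (unity cs r d c).
have a1 : `|dmass_int s (fun x => f x * cutoff r x) - S| <= e * (M + d).
  have -> : S = dmass_int s (fun x => \sum_(c <- cs) f c * unity cs r d c x).
    rewrite /S /dmass_int; under eq_bigr do rewrite mulr_sumr.
    rewrite exchange_big /=; apply: eq_bigr => p _; rewrite mulr_sumr.
    by apply: eq_bigr => c _; rewrite mulrCA.
  apply: (@le_trans _ _ (dmass_int s (fun x => e * cutoff r x))).
    by apply: dmass_int_dist => // x; exact: unity_approx.
  by rewrite dmass_intZ ler_wpM2l.
have a2 : `|mint mu f - Smu| <= e * M.
  rewrite /Smu -mint_lincomb//; apply: (mint_close mu0) => //; first exact: C0_lincomb.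
  move=> x xr; have := unity_approx (den0 x) fe; rewrite cutoff_in// !mulr1.
  by [].
have a3 : `|S - Smu| <= B * d.
  rewrite /S /Smu -sumrB; apply: (le_trans (ler_norm_sum _ _ _)).
  apply: (@le_trans _ _ (\sum_(c <- cs) B * (j.+1 * (size cs).+1)%:R^-1)).
    rewrite big_seq [leRHS]big_seq; apply: ler_sum => c cc.
    by rewrite -mulrBr normrM ler_pM// H1.
  rewrite big_const_seq count_predT iter_addr_0 -mulrnAr ler_wpM2l//.
  rewrite natrM invfM -mulrnAr -[leRHS]mulr1 ler_wpM2l ?(ltW d0)//.
  by rewrite -mulr_natl ler_pdivrMr// mul1r ler_nat.
have a4 : `|dmass_int (trunc_mass lev s) f - dmass_int s (fun x => f x * cutoff r x)|
    <= B * (2 * d).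
  apply: (@le_trans _ _ (dmass_int s (fun x => B * (cutoff (r + 1 + L) x - cutoff r x)))).
    rewrite dmass_int_trunc; apply: dmass_int_dist => // x.
    rewrite -mulrBr normrM ler_pM//; case: (leP `|x| lev) => xl.
      rewrite (@cutoff_in _ _ (r + 1 + L)); last exact: (le_trans xl lev2).
      by rewrite ger0_norm ?subr_ge0 ?cutoff_le1.
    rewrite (@cutoff_out _ _ r); last exact: (le_trans lev1 (ltW xl)).
    by rewrite !subr0 normr0 cutoff_ge0.
  by rewrite dmass_intZ dmass_intB ler_wpM2l.
have a5 : `|dmass_int ci f| <= B * d.
  have := @dmass_int_dist ci f (fun=> 0) (fun=> B) okci.
  have -> : dmass_int ci (fun=> 0) = 0 by rewrite /dmass_int big1// => p _; rewrite mulr0.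
  have -> : dmass_int ci (fun=> B) = B * dmass_total ci.
    by rewrite -dmass_int1 -dmass_intZ; apply: eq_bigr => p _; rewrite mulr1.
  rewrite subr0 => H; apply: le_trans (H _) _; last by rewrite ler_wpM2l.
  by move=> x; rewrite subr0.
rewrite dmass_int_cat; have ed : e * d <= e by rewrite ler_piMr.
move: a1 a2 a3 a4 a5; rewrite !ler_norml.
set p1 := dmass_int s _; set p2 := mint mu f; set p3 := dmass_int _ f; set p4 := dmass_int ci f.
rewrite mulrDr; move=> /andP[? ?] /andP[? ?] /andP[? ?] /andP[? ?] /andP[? ?]; lra.
Qed.

Lemma weakly_close_cvg (T : nat -> dmass R n) mu (h : nat -> nat) :
  (forall j, (j <= h j)%N) -> (forall j, weakly_close j (T j) mu) ->
  forall f, C0 f -> dmass_int (T (h j)) f @[j --> \oo] --> mint mu f.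
Proof.
move=> hj HT f Cf; have [B B0 fB] := C0_bounded Cf.
apply/cvgrPdist_le => e e0; pose M := fine (mu setT).
have M0 : 0 <= M by rewrite fine_ge0.
have e10 : 0 < e / 2 / (2 * M + 1) by rewrite !divr_gt0//; lra.
have [d d0 fd] := C0_unif_continuous Cf e10.
have e20 : 0 < e / 2 / (4 * B + 1) by rewrite !divr_gt0//; lra.
have [N1 _ HN1] := near_infty_natSinv_lt (PosNum d0).
have [N2 _ HN2] := near_infty_natSinv_lt (PosNum e20).
exists (maxn N1 N2) => // j /=; rewrite geq_max => /andP[Nj1 Nj2].
have := HN1 _ (leq_trans Nj1 (hj j)); have := HN2 _ (leq_trans Nj2 (hj j)) => /=.
set q := _^-1 => q2 q1; rewrite distrC.
apply: (le_trans (HT (h j) f B (e / 2 / (2 * M + 1)) Cf fB _)).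
  by move=> x y xy; apply/ltW/fd; apply: lt_trans q1.
have -> : e / 2 / (2 * M + 1) * (2 * fine (mu setT) + 1) = e / 2.
  by rewrite divfK// gt_eqF//; rewrite -/M; lra.
have q0 : 0 < q by rewrite invr_gt0.
have : q * (4 * B + 1) < e / 2 by rewrite -ltr_pdivlMr//; lra.
rewrite -/q; nra.
Qed.

End Closeness.

(** * Existence of minimizers *)

Lemma near_all_seq (I : eqType) (cs : seq I) (P : I -> nat -> Prop) :
  (forall c, c \in cs -> \forall k \near \oo, P c k) ->
  \forall k \near \oo, forall c, c \in cs -> P c k.
Proof.
elim: cs => [|c cs IH] H; first by exists 0%N.
have H1 := H c (mem_head _ _).
have H2 : \forall k \near \oo, forall c, c \in cs -> P c k.
  by apply: IH => c' c'cs; apply: H; rewrite inE c'cs orbT.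
apply: filterS (filterI H1 H2) => k [P1 P2] c'; rewrite inE.
by move=> /predU1P[->//|/P2].
Qed.

Section Existence.
Variables (R : realType) (n : nat) (tau : R -> R) (mup mum : fmeasure R n).
Hypothesis tc : transportation_cost tau.
Local Notation V := 'rV[R]_n.

Lemma support_weaken (mu : fmeasure R n) (r r' : R) : r <= r' ->
  mu [set x : borelRn R n | r < `|x : V|] = 0%E ->
  mu [set x : borelRn R n | r' < `|x : V|] = 0%E.
Proof.
move=> rr'; apply: subset_measure0; [exact: measurable_norm_gt..|].
by move=> x /=; exact: le_lt_trans.
Qed.

Lemma gcost_ge0 sp sm (G : graph R n) : is_dflux sp sm G -> 0 <= gcost tau G.
Proof.
move=> [_ _ HE _]; rewrite /gcost big_seq sumr_ge0// => e /HE[_ e0 _ _].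
by rewrite mulr_ge0 ?(tc_ge0 tc)// sqrtr_ge0.
Qed.

Lemma Jrel_ge0 F : (0 <= Jrel tau mup mum F)%E.
Proof.
apply: le_ereal_inf_tmp => _ [sp [sm [G [[H _ _ _] ->]]]].
by apply: limn_einf_ge0 => k; have [_ _ /gcost_ge0] := H k.
Qed.

Lemma approximation_stage (r m0 : R) (j : nat) (F : vmeasure R n) :
  mup [set x : borelRn R n | r < `|x : V|] = 0%E ->
  mum [set x : borelRn R n | r < `|x : V|] = 0%E ->
  0 <= m0 -> (Jrel tau mup mum F < (m0 + j.+1%:R^-1)%:E)%E ->
  exists T : dmass R n * dmass R n * graph R n,
    [/\ dmass_ok T.1.1 /\ dmass_ok T.1.2, is_dflux T.1.1 T.1.2 T.2,
        gcost tau T.2 <= m0 + j.+1%:R^-1,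
        weakly_close j T.1.1 mup /\ weakly_close j T.1.2 mum &
        forall q, q \in gedges T.2 -> 0 <= q.2 <= fine (mum setT) + 2].
Proof.
move=> supp supm m00 /ereal_inf_lt[_ [sp [sm [G [[H Hp Hm _] ->]]]] HJ].
have [_ tp _ _ _] := tc; have t1 : 0 < tau 1 by exact: tp.
set d : R := j.+1%:R^-1 in HJ *.
have d0 : 0 < d by rewrite invr_gt0.
have d1 : d <= 1 by rewrite invf_le1// ler1n.
(* [C] bounds the cost at every stage; [L] is solved from [4 * C / (L * tau 1) = d], so the cut mass
   is at most [d]. *)
pose C := m0 + 1; have C_gt0 : 0 < C by rewrite /C; lra.
pose L := j.+1%:R * (4 * C) / tau 1.
have L0 : 0 < L by rewrite divr_gt0// mulr_gt0// mulr_gt0.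
have CL : 4 * C / (L * tau 1) = d.
  by rewrite /L /d divfK ?gt_eqF// invfM mulrCA divff ?mulr1// gt_eqF// mulr_gt0.
have CL2 : 2 * C / L < tau 1.
  have -> : 2 * C / L = d * tau 1 / 2.
    by rewrite -CL; field; rewrite !gt_eqF.
  rewrite ltr_pdivrMr//; nra.
have [cs net] := @ball_net R n (r + 1) d d0.
have Cu c : C0 (unity cs r d c) by apply: unity_C0; exact: bump_sum_gt0.
have near1 (s : nat -> dmass R n) (mu : fmeasure R n) (f : V -> R) e : 0 < e ->
    (forall f, C0 f -> dmass_int (s k) f @[k --> \oo] --> mint mu f) -> C0 f ->
    \forall k \near \oo, `|dmass_int (s k) f - mint mu f| <= e.
  by move=> e0 Hs /Hs/cvgrPdistC_le; apply.
(* The tolerance is divided by the size of the net, so that the errors of all its functions add up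
   to at most [d]; the successor admits an empty net. *)
have tol0 : 0 < (j.+1 * (size cs).+1)%:R^-1 :> R by rewrite invr_gt0 ltr0n muln_gt0.
have nearU (s : nat -> dmass R n) (mu : fmeasure R n) :
    (forall f, C0 f -> dmass_int (s k) f @[k --> \oo] --> mint mu f) ->
    \forall k \near \oo,
     [/\ forall c, c \in cs -> `|dmass_int (s k) (unity cs r d c) - mint mu (unity cs r d c)|
         <= (j.+1 * (size cs).+1)%:R^-1,
       `|dmass_int (s k) (cutoff r) - mint mu (cutoff r)| <= d &
       `|dmass_int (s k) (cutoff (r + 1 + L)) - mint mu (cutoff (r + 1 + L))| <= d].
  move=> Hs.
  have E1 : \forall k \near \oo, forall c, c \in cs ->
      `|dmass_int (s k) (unity cs r d c) - mint mu (unity cs r d c)|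
         <= (j.+1 * (size cs).+1)%:R^-1.
    by apply: near_all_seq => c _; apply: near1.
  have E2 := near1 s mu (cutoff r) d d0 Hs (cutoff_C0 _ _).
  have E3 := near1 s mu (cutoff (r + 1 + L)) d d0 Hs (cutoff_C0 _ _).
  by apply: filterS (filterI E1 (filterI E2 E3)) => k [? [? ?]].
have [K _ HK] := filterI (nearU sp mup Hp) (nearU sm mum Hm).
have [k Kk] := limn_einf_lt_frequently HJ K; rewrite lte_fin => costk.
have [[P1 P2 P3] [M1 M2 M3]] := HK k Kk.
have [okp okm GF] := H k.
have costC : gcost tau (G k) <= C by rewrite /C; lra.
have [lev [ci [co [G' [levb [okci okco] [tci tco] GF' [cost' wb]]]]]] :=
  truncated_flux (r + 1) tc okp okm GF costC C_gt0 L0 CL2.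
rewrite CL in tci tco.
have [clp _] := truncated_mass_close supp L0 okp okci net tci levb P1 P2 P3.
have [clm totm] := truncated_mass_close supm L0 okm okco net tco levb M1 M2 M3.
exists (trunc_mass lev (sp k) ++ ci, trunc_mass lev (sm k) ++ co, G'); split => //=.
- have okt s : dmass_ok s -> dmass_ok (trunc_mass lev s).
    by move=> /allP Hs; apply/allP => p; rewrite mem_filter => /andP[_ /Hs].
  by split; rewrite /dmass_ok all_cat; apply/andP; split => //; exact: okt.
- by apply: (le_trans cost'); exact: ltW.
- by move=> q /wb/andP[-> /le_trans] /= -> .
Qed.

Lemma minimizer_exists (m0 r : R) :
  mup [set x : borelRn R n | r < `|x : V|] = 0%E ->
  mum [set x : borelRn R n | r < `|x : V|] = 0%E ->
  ereal_inf (range (Jrel tau mup mum)) = m0%:E -> 0 <= m0 ->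
  exists F, (Jrel tau mup mum F <= m0%:E)%E.
Proof.
move=> supp supm infE m00; have [_ tp _ _ _] := tc.
have /choice[T TP] (j : nat) : exists T : dmass R n * dmass R n * graph R n,
    [/\ dmass_ok T.1.1 /\ dmass_ok T.1.2, is_dflux T.1.1 T.1.2 T.2,
        gcost tau T.2 <= m0 + j.+1%:R^-1,
        weakly_close j T.1.1 mup /\ weakly_close j T.1.2 mum &
        forall q, q \in gedges T.2 -> 0 <= q.2 <= fine (mum setT) + 2].
  have : (ereal_inf (range (Jrel tau mup mum)) < (m0 + j.+1%:R^-1)%:E)%E.
    by rewrite infE lte_fin ltrDl invr_gt0.
  by move=> /ereal_inf_lt[_ [F _ <-] JF]; exact: approximation_stage supp supm m00 JF.
(* The stage bound on the weights: the mass of [mum], plus 1 for the test error and 1 for the cut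
   edges. On [[0, M]] the linear bound turns cost at most [m0 + 1] into total variation at most
   [C]. *)
pose M := fine (mum setT) + 2.
have M0 : 0 < M by rewrite ltr_wpDl// fine_ge0.
have tM : 0 < tau M by exact: tp.
pose C := 2 * M / tau M * (m0 + 1).
have wT j q : q \in gedges (T j).2 -> 0 <= q.2 by have [_ _ _ _ H] := TP j; move=> /H/andP[].
have TV j : \sum_(q <- gedges (T j).2) q.2 * `|q.1.2 - q.1.1| <= C.
  have [_ _ cj _ HM] := TP j.
  apply: (@le_trans _ _ (2 * M / tau M * gcost tau (T j).2)); last first.
    rewrite ler_wpM2l ?divr_ge0 ?mulr_ge0 ?(ltW M0) ?(ltW tM)//.
    by apply: (le_trans cj); rewrite lerD2l invf_le1// ler1n.
  rewrite /gcost mulr_sumr big_seq [leRHS]big_seq; apply: ler_sum => q /HM qM.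
  apply: (@le_trans _ _ (q.2 * enorm (q.1.2 - q.1.1))).
    by rewrite ler_wpM2l ?norm_le_enorm//; case/andP: qM.
  rewrite mulrA ler_wpM2r ?sqrtr_ge0// mulrAC ler_pdivlMr//.
  exact: tc_linear_bound.
have [h [F [hS HF]]] := @flux_compactness _ _ (fun j => (T j).2) C wT TV.
have hj j : (j <= h j)%N by elim: j => // j IH; apply: leq_ltn_trans (hS j).
exists F; apply: (@le_trans _ _ (limn_einf (fun j => (gcost tau (T (h j)).2)%:E))).
  apply: ereal_inf_lbound.
  exists (fun j => (T (h j)).1.1), (fun j => (T (h j)).1.2), (fun j => (T (h j)).2).
  split => //; split => //.
  - by move=> k; have [[? ?] ? _ _ _] := TP (h k).
  - by apply: (@weakly_close_cvg _ _ (fun j => (T j).1.1)) => // j; have [_ _ _ []] := TP j.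
  - by apply: (@weakly_close_cvg _ _ (fun j => (T j).1.2)) => // j; have [_ _ _ []] := TP j.
apply: limn_einf_le => e e0.
have [N _ HN] := near_infty_natSinv_lt (PosNum e0).
exists N => k Nk; have [_ _ ck _ _] := TP (h k); apply: (le_trans ck).
by rewrite lerD2l; apply: ltW; exact: HN (leq_trans Nk (hj k)).
Qed.

End Existence.

Unset Implicit Arguments.

Theorem mainTheorem1 (R : realType) (n : nat) (tau : R -> R)
  (mup mum : fmeasure R n) :
  transportation_cost tau ->
  bounded_support mup -> bounded_support mum ->
  (exists F : vmeasure R n, forall F' : vmeasure R n,
      (Jrel tau mup mum F <= Jrel tau mup mum F')%E)
  \/ (forall F : vmeasure R n, Jrel tau mup mum F = +oo%E).
Proof.
move=> tc [rp Hp] [rm Hm].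
set J := Jrel tau mup mum.
have lbJ F : (ereal_inf (range J) <= J F)%E by apply: ereal_inf_lbound; exists F.
have inf0 : (0 <= ereal_inf (range J))%E.
  by apply: le_ereal_inf_tmp => _ [F _ <-]; exact: Jrel_ge0.
(* Nonnegativity excludes [-oo], so the infimum is real or [+oo]; these are the two alternatives. *)
case E : (ereal_inf (range J)) inf0 => [m0| |] //; last first.
  by move=> _; right => F; apply/eqP; rewrite -leye_eq -E.
rewrite lee_fin => m00; left.
have rpr : rp <= Num.max rp rm by rewrite le_max lexx.
have rmr : rm <= Num.max rp rm by rewrite le_max lexx orbT.
have [F HF] := minimizer_exists tc (support_weaken rpr Hp) (support_weaken rmr Hm) E m00.
by exists F => F'; apply: (le_trans HF); rewrite -E.
Qed.
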